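(* Let $(G,P)$ be a quasi-lattice ordered group with Nica spectrum $\Omega$ and boundary spectrum $\partial\Omega$. If the canonical partial action of $G$ on $\partial\Omega$ is both amenable and topologically free, then the boundary quotient $C(\partial\Omega)\rtimes G$ is purely infinite and simple.
   Context: Groups are countable. A quasi-lattice ordered group $(G,P)$ is a group $G$ with a submonoid $P$ with $P\cap P^{-1}=\{e\}$ such that, for the left-invariant partial order $x\le y\iff x^{-1}y\in P$, every two elements of $G$ having a common upper bound have a least upper bound $x\vee y$; write $x\vee y=\infty$ if there is no common upper bound. Nica spectrum: $\Omega$ is the set of $\omega\subset G$ with $e\in\omega$ that are hereditary ($\omega P^{-1}\subset\omega$) and directed ($x\vee y\ne\infty$ and $x\vee y\in\omega$ for $x,y\in\omega$), with the (compact Hausdorff) topology from $\{0,1\}^G$. $G$ acts partially on $\Omega$ by $\theta_t:U_{t^{-1}}\to U_t$, $\omega\mapsto t\omega$, where $U_t=\{\omega:t\in\omega\}$. The boundary spectrum $\partial\Omega$ is the closure in $\Omega$ of the set of maximal directed subsets of $G$ containing $e$ (these are automatically hereditary); it is closed and invariant, and the partial action restricts to it. Crossed products: for a closed invariant $X\subset\Omega$ let $D_t=C_0(U_t\cap X)$ and $\alpha_t:D_{t^{-1}}\to D_t$, $f\mapsto f\circ\theta_{t^{-1}}$. $C(X)\rtimes G$ is the full partial crossed product: the universal C*-completion of finite sums $\sum f_t\delta_t$, $f_t\in D_t$, with $(f\delta_s)(g\delta_t)=\alpha_s(\alpha_{s^{-1}}(f)g)\delta_{st}$ and $(f\delta_t)^*=\alpha_{t^{-1}}(\bar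 f)\delta_{t^{-1}}$. The partial action on $X$ is amenable if the canonical map from the full to the reduced crossed product is an isomorphism; equivalently, the conditional expectation $\Phi:C(X)\rtimes G\to C(X)$ with $\Phi(f\delta_e)=f$, $\Phi(f\delta_g)=0$ for $g\neq e$, is faithful on positive elements. It is topologically free if for every $t\in G\setminus\{e\}$ the fixed set $\{\omega\in X\cap U_{t^{-1}}:t\omega=\omega\}$ has empty interior in $X$. ''Purely infinite'' has its standard meaning for simple C*-algebras: every nonzero hereditary C*-subalgebra contains an infinite projection.
   Formalization: The formal theorem additionally assumes that P is not the trivial submonoid {e}; for P = {e} the boundary quotient is the complex numbers, which is simple but not purely infinite, so the claim fails there. *)

(* Defs.v *)
From HB Require Import structures.
From mathcomp Require Import all_boot all_order all_algebra.
From mathcomp Require Import all_classical all_reals all_analysis.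
From mathcomp Require Import complex.

Set Implicit Arguments.
Unset Strict Implicit.
Unset Printing Implicit Defensive.

Import Order.TTheory GRing.Theory Num.Theory.
Import numFieldNormedType.Exports.

Local Open Scope classical_set_scope.
Local Open Scope ring_scope.
Local Open Scope complex_scope.

(* C*-algebras are not required to have a unit, so the product is not the one
   of a MathComp ring. Over [R[i]] the norm takes its values in [R[i]]. *)
HB.mixin Record CompleteNormedModule_isCStar (R : realType) A
    of CompleteNormedModule R[i] A := {
  cmul : A -> A -> A;
  cstar : A -> A;
  cmulA : forall x y z : A, cmul x (cmul y z) = cmul (cmul x y) z;
  cmulDl : forall x y z : A, cmul (x + y) z = cmul x z + cmul y z;
  cmulDr : forall x y z : A, cmul x (y + z) = cmul x y + cmul x z;
  cmulZl : forall (k : R[i]) (x y : A), cmul (k *: x) y = k *: cmul x y;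
  cmulZr : forall (k : R[i]) (x y : A), cmul x (k *: y) = k *: cmul x y;
  cstarK : forall x : A, cstar (cstar x) = x;
  cstarD : forall x y : A, cstar (x + y) = cstar x + cstar y;
  cstarZ : forall (k : R[i]) (x : A), cstar (k *: x) = k^* *: cstar x;
  cstarM : forall x y : A, cstar (cmul x y) = cmul (cstar y) (cstar x);
  cnormM : forall x y : A, `|cmul x y| <= `|x| * `|y|;
  cnorm_star : forall x : A, `|cmul (cstar x) x| = `|x| ^+ 2
}.

#[short(type="cstarType")]
HB.structure Definition CStar (R : realType) :=
  {A of CompleteNormedModule_isCStar R A & CompleteNormedModule R[i] A}.

Section CStarAlgebras.
Context {R : realType}.

Definition star_hom (A B : cstarType R) (f : A -> B) : Prop :=
  [/\ forall (k : R[i]) (x y : A), f (k *: x + y) = k *: f x + f y,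
      forall x y : A, f (cmul x y) = cmul (f x) (f y)
    & forall x : A, f (cstar x) = cstar (f x)].

Context {A : cstarType R}.

Definition cpositive (x : A) : Prop := exists y : A, x = cmul (cstar y) y.

Definition linear_subspace (I : set A) : Prop :=
  I 0 /\ forall (k : R[i]) (x y : A), I x -> I y -> I (k *: x + y).

Definition closed_ideal (I : set A) : Prop :=
  [/\ closed I, linear_subspace I
    & forall x y : A, I x -> I (cmul x y) /\ I (cmul y x)].

Definition hereditary_subalgebra (B : set A) : Prop :=
  [/\ closed B, linear_subspace B,
      forall x y : A, B x -> B y -> B (cmul x y),
      forall x : A, B x -> B (cstar x)
    & forall x y : A, B y -> cpositive x -> cpositive (y - x) -> B x].

Definition projection (p : A) : Prop := cstar p = p /\ cmul p p = p.

(* [p] is Murray-von Neumann equivalent to a proper subprojection [q]. *)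
Definition infinite_projection (p : A) : Prop :=
  projection p /\
  exists v q : A, [/\ projection q, cmul p q = q, q <> p,
    cmul (cstar v) v = p & cmul v (cstar v) = q].

End CStarAlgebras.

Definition cstar_simple (R : realType) (A : cstarType R) : Prop :=
  (exists x : A, x <> 0) /\
  forall I : set A, closed_ideal I -> I = [set 0] \/ I = setT.

Definition purely_infinite (R : realType) (A : cstarType R) : Prop :=
  forall B : set A, hereditary_subalgebra B -> (exists2 x, B x & x <> 0) ->
    exists2 p, B p & infinite_projection p.

Section QuasiLattice.
Local Open Scope group_scope.
Context {G : groupType}.
Implicit Types (P : set G) (x y z : G).

Definition submonoid P : Prop := P 1 /\ forall x y, P x -> P y -> P (x * y).

Definition qle P x y : Prop := P (x^-1 * y).

Definition upper_bound P x y z : Prop := qle P x z /\ qle P y z.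

(* [z] is the least upper bound of [x] and [y]; in particular their join is
   finite. *)
Definition is_join P x y z : Prop :=
  upper_bound P x y z /\ forall w, upper_bound P x y w -> qle P z w.

Definition quasi_lattice_ordered P : Prop :=
  [/\ submonoid P,
      P `&` [set x | P x^-1] = [set 1]
    & forall x y, (exists z, upper_bound P x y z) -> exists z, is_join P x y z].

(* {0,1}^G with the product topology; [w] stands for the set of the [t] such
   that [w t] holds. *)
Definition subsets (T : groupType) := {ptws T -> bool}.

Implicit Types (w v : subsets G) (X : set (subsets G)).

Definition hereditary_subset P w : Prop :=
  forall x p, w x -> P p -> w (x * p^-1).

Definition directed_subset P w : Prop :=
  forall x y, w x -> w y -> exists2 z, is_join P x y z & w z.

Definition nica_spectrum P : set (subsets G) :=
  [set w : subsets G | [/\ w 1, hereditary_subset P w & directed_subset P w]].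

Definition maximal_directed P : set (subsets G) :=
  [set w : subsets G | [/\ w 1, directed_subset P w &
    forall v, directed_subset P v -> (forall x, w x -> v x) -> v = w]].

(* The closure is relative to the Nica spectrum. *)
Definition boundary_spectrum P : set (subsets G) :=
  nica_spectrum P `&` closure (maximal_directed P).

Definition translate (t : G) (w : subsets G) : subsets G :=
  fun s => w (t^-1 * s).

(* The partial homeomorphism indexed by [t] is [translate t] on the [w] such
   that [w t^-1]. *)
Definition topologically_free X : Prop :=
  forall t, t <> 1 -> forall O : set (subsets G), open O ->
    O `&` X `<=` [set w : subsets G | w t^-1 /\ translate t w = w] -> O `&` X = set0.

End QuasiLattice.

Section CrossedProducts.
Context {R : realType} {G : groupType}.
Variable X : set (subsets G).

(* C_0(U_t n X), where U_t is the set of the [w] such that [w t]. As X is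
   compact and U_t is open, these are the continuous functions on X that vanish
   off U_t; they are extended by 0 to all of {0,1}^G, so that equality of
   functions on X is equality of the extensions. *)
Definition C0_U (t : G) (f : subsets G -> R[i]) : Prop :=
  {within X, continuous (f : subsets G -> R[i]^o)} /\ forall w, ~ (X w /\ w t) -> f w = 0.

(* Used for [f] in C_0(U_(t^-1) n X) and [X] invariant; the result is then in
   C_0(U_t n X). *)
Definition alpha (t : G) (f : subsets G -> R[i]) : subsets G -> R[i] :=
  fun w => if w t then f (translate t^-1%g w) else 0.

(* [a : G -> subsets G -> R[i]] stands for the sum of the [a t] delta_t. *)
Definition finite_sum (a : G -> subsets G -> R[i]) : Prop :=
  (forall t, C0_U t (a t)) /\ finite_set [set t | exists w, a t w <> 0].

Definition fs_lin (k : R[i]) (a b : G -> subsets G -> R[i]) :=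
  fun t w => k * a t w + b t w.

Definition fs_mul (a b : G -> subsets G -> R[i]) : G -> subsets G -> R[i] :=
  fun r w => \sum_(s \in [set: G])
    alpha s (fun v => alpha s^-1%g (a s) v * b (s^-1 * r)%g v) w.

Definition fs_star (a : G -> subsets G -> R[i]) : G -> subsets G -> R[i] :=
  fun r => alpha r (fun w => (a r^-1%g w)^*).

Definition star_rep (B : cstarType R) (pi : (G -> subsets G -> R[i]) -> B) :=
  forall a b, finite_sum a -> finite_sum b ->
  [/\ forall k, pi (fs_lin k a b) = k *: pi a + pi b,
      pi (fs_mul a b) = cmul (pi a) (pi b)
    & pi (fs_star a) = cstar (pi a)].

Definition full_crossed_product (A : cstarType R)
    (i : (G -> subsets G -> R[i]) -> A) : Prop :=
  [/\ star_rep i,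
      closure (i @` finite_sum) = setT
    & forall (B : cstarType R) (pi : (G -> subsets G -> R[i]) -> B),
        star_rep pi ->
        exists2 f : A -> B, star_hom f & forall a, finite_sum a -> f (i a) = pi a].

Definition sup_norm (f : subsets G -> R[i]) : R :=
  sup [set complex.Re `|f w| | w in X].

(* The norm of the C(X)-valued inner product <a, b> = (a^* b)(e), whose
   completion is the Hilbert C(X)-module of the square-summable families
   (f_t) with f_t in D_t. *)
Definition l2_norm (a : G -> subsets G -> R[i]) : R :=
  Num.sqrt (sup_norm (fs_mul (fs_star a) a 1%g)).

(* The operator norm of the left regular representation on that module. *)
Definition reduced_norm (a : G -> subsets G -> R[i]) : R :=
  sup [set l2_norm (fs_mul a x) | x in
    [set x | finite_sum x /\ l2_norm x <= 1]].

Definition reduced_crossed_product (A : cstarType R)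
    (j : (G -> subsets G -> R[i]) -> A) : Prop :=
  [/\ star_rep j,
      closure (j @` finite_sum) = setT
    & forall a, finite_sum a -> `|j a| = (reduced_norm a)%:C].

End CrossedProducts.

(* Both crossed products are unique up to an isomorphism commuting with the
   maps from finite sums, so it does not matter which ones are exhibited. *)
Definition amenable (R : realType) (G : groupType) (X : set (subsets G)) : Prop :=
  exists (A Ar : cstarType R) (i : (G -> subsets G -> R[i]) -> A)
         (j : (G -> subsets G -> R[i]) -> Ar) (f : A -> Ar),
  [/\ full_crossed_product X i, reduced_crossed_product X j, star_hom f,
      forall a, finite_sum X a -> f (i a) = j a
    & bijective f].

(* Main.v *)
Require Import Defs.
From HB Require Import structures.
From mathcomp Require Import all_boot all_order all_algebra.
From mathcomp Require Import all_classical all_reals all_analysis.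
From mathcomp Require Import complex.
From mathcomp Require Import ring lra.

(** Let X be the boundary spectrum, U_p the set of the w in X that contain p,
    and e the unit of the crossed product. For p in P, the element
    v = 1_{U_p} delta_p is an isometry. A nonempty open subset of X contains
    some nonempty U_p with p in P, and by topological freeness p can be chosen so
    that compression by v kills any given finite set of coefficients at group
    elements other than 1. So for a finite sum c the element v^* c v is
    approximately a scalar, the value near a given point of the coefficient of c
    at 1.

    Amenability says that the norm of a finite sum b is its reduced norm. So if
    x <> 0 and b is close to x, there is a finite sum z of l2-norm at most 1 such
    that the coefficient at 1 of (b z)^* (b z) is large at some point. Compressing
    near that point and rescaling yields y such that (x y)^* (x y) is at distance
    at most 1/2 from e, hence is k^2 with k self-adjoint and invertible. An ideal
    containing x is then everything, and for x in a hereditary subalgebra,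
    u = x y k^-1 satisfies u^* u = e while u u^* belongs to the subalgebra. As P
    is not trivial, some v is a proper isometry, and u u^* is infinite.

    No spectral theory is needed: the square roots of e - y with |y| <= 1/2 come
    from a contraction, and norms of images of self-adjoint elements are bounded
    by writing the latter as real parts of unitaries. *)

Set Implicit Arguments.
Unset Strict Implicit.
Unset Printing Implicit Defensive.

Import Order.TTheory GRing.Theory Num.Theory.
Import numFieldNormedType.Exports.

Local Open Scope classical_set_scope.
Local Open Scope ring_scope.
Local Open Scope complex_scope.

(** * Real-valued norms *)

Section RealNorm.
Context {R : realType} {V : normedModType R[i]}.
Implicit Types x y : V.

(* The norm of a normed space over [R[i]] is [R[i]]-valued; its real part is
   a real-valued norm. *)
Definition nrm (x : V) : R := complex.Re `|x|.

Lemma nrmE x : `|x| = (nrm x)%:C.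
Proof. by rewrite RRe_real // ger0_real. Qed.

Lemma nrm_ge0 x : 0 <= nrm x.
Proof. by rewrite -ler0c -nrmE. Qed.

Lemma nrm0_eq0 x : nrm x = 0 -> x = 0.
Proof. by move=> h; apply/eqP; rewrite -normr_eq0 nrmE h. Qed.

Lemma nrm0 : nrm (0 : V) = 0.
Proof. by rewrite /nrm normr0. Qed.

Lemma nrm_gt0 x : x <> 0 -> 0 < nrm x.
Proof.
move=> x0; rewrite lt_neqAle nrm_ge0 andbT; apply/eqP => /esym.
by move/nrm0_eq0.
Qed.

Lemma nrmD x y : nrm (x + y) <= nrm x + nrm y.
Proof. by rewrite -lecR rmorphD /= -!nrmE ler_normD. Qed.

Lemma nrmN x : nrm (- x) = nrm x.
Proof. by rewrite /nrm normrN. Qed.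

Lemma nrmBC x y : nrm (x - y) = nrm (y - x).
Proof. by rewrite -nrmN opprB. Qed.

Lemma nrm_sub_trans z x y : nrm (x - y) <= nrm (x - z) + nrm (z - y).
Proof. by apply: le_trans (nrmD _ _); rewrite addrA subrK. Qed.

Lemma nrmZ (k : R[i]) x : nrm (k *: x) = complex.Re `|k| * nrm x.
Proof.
have kE : `|k| = (complex.Re `|k|)%:C by rewrite RRe_real // ger0_real.
by rewrite /nrm normrZ {1}kE (nrmE x) -rmorphM.
Qed.

Lemma Re_norm_real (k : R) : complex.Re `|k%:C| = `|k|.
Proof. by rewrite normc_def /= expr0n addr0 sqrtr_sqr. Qed.

Lemma nrmZr (k : R) x : nrm (k%:C *: x) = `|k| * nrm x.
Proof. by rewrite nrmZ Re_norm_real. Qed.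

Lemma eq_of_nrm_small x y : (forall e : R, 0 < e -> nrm (x - y) <= e) -> x = y.
Proof.
move=> h; apply/eqP; rewrite -subr_eq0; apply/eqP/nrm0_eq0/eqP.
by rewrite eq_le nrm_ge0 andbT; apply/ler_addgt0Pr => e /h; rewrite add0r.
Qed.

Lemma closure_nrm (S : set V) x : closure S x ->
  forall e : R, 0 < e -> exists2 y, S y & nrm (x - y) < e.
Proof.
move=> clS e e0; have e0C : 0 < (e%:C : R[i]) by rewrite ltcR.
have [y [Sy]] := clS _ (nbhsx_ballx x _ e0C).
by rewrite -ball_normE /= nrmE ltcR => ?; exists y.
Qed.

End RealNorm.

(** * A contraction principle in complete normed spaces *)

Section FixedPoint.
Context {R : realType} {V : completeNormedModType R[i]}.

(** Both estimates hold at the same [n]: the distance from the limit to [u n.+1] is bounded through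
    that to [u n] plus one increment. *)
Lemma nrm_limit (u : nat -> V) (d : R) :
  (forall n k, nrm (u n - u (n + k)%N) <= d / 2 ^+ n) ->
  exists l, forall e : R, 0 < e ->
    exists n, nrm (l - u n) <= e /\ d / 2 ^+ n <= e.
Proof.
move=> hu.
have small (e : R) : 0 < e -> exists n, d / 2 ^+ n < e.
  move=> e0; have [n hn] : exists n : nat, d / e < n%:R.
    exists (Num.bound `|d / e|); apply: le_lt_trans (ler_norm _) _.
    exact: archi_boundP.
  exists n; rewrite ltr_pdivrMr ?exprn_gt0 // mulrC -ltr_pdivrMr //.
  apply: lt_trans hn _; rewrite -natrX ltr_nat; exact: ltn_expl.
have cu : cauchy (u @ \oo).
  apply: cauchy_exP => e e0.
  have eE : e = (complex.Re e)%:C by rewrite RRe_real // gtr0_real.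
  have e0' : 0 < complex.Re e by rewrite -ltcR -eE.
  have [n hn] := small _ e0'; exists (u n); exists n => //= m /= nm.
  rewrite -ball_normE /= nrmE eE ltcR; apply: le_lt_trans hn.
  by rewrite -(subnKC nm).
have /cauchy_cvgP/cvg_ex[l ul] := cu; exists l => e e0.
have e0C : 0 < (e%:C : R[i]) by rewrite ltcR.
have [m _ hm] := ul _ (nbhsx_ballx l _ e0C).
have [n hn] := small _ e0; exists (m + n)%N; split.
  have := hm _ (leq_addr n m); rewrite -ball_normE /= nrmE ltcR; exact: ltW.
have d0 : 0 <= d by have := hu 0%N 0%N; rewrite expr0 divr1; apply/le_trans/nrm_ge0.
apply: le_trans (ltW hn); rewrite ler_wpM2l // lef_pV2 ?posrE ?exprn_gt0 //.
by rewrite ler_weXn2l ?leq_addl // ler1n.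
Qed.

(** Banach's fixed point theorem with ratio 1/2; the third hypothesis says that [U] is closed.
    Square roots and inverses near the unit come from it. *)
Lemma contraction_fixpoint (T : V -> V) (U : set V) (x0 : V) :
  U x0 -> (forall x, U x -> U (T x)) ->
  (forall x, (forall e : R, 0 < e -> exists2 y, U y & nrm (x - y) <= e) -> U x) ->
  (forall x y, U x -> U y -> nrm (T x - T y) <= nrm (x - y) / 2) ->
  exists2 x, U x & T x = x.
Proof.
move=> Ux0 UT clU ctr; pose u n := iter n T x0.
have Uu n : U (u n) by elim: n => //= n /UT.
pose d := nrm (x0 - T x0).
(* Geometric series: one step costs [d], and the rest at most half of [2 * d]. *)
have h0 k : nrm (x0 - u k) <= 2 * d.
  elim: k => [|k IH]; first by rewrite subrr nrm0 mulr_ge0 ?nrm_ge0.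
  apply: le_trans (nrm_sub_trans (T x0) _ _) _.
  have := ctr _ _ Ux0 (Uu k); rewrite /= -/d; lra.
have hu n k : nrm (u n - u (n + k)%N) <= (2 * d) / 2 ^+ n.
  elim: n => [|n IH]; first by rewrite expr0 divr1 add0n.
  rewrite exprS invfM mulrCA mulrC addSn /=.
  apply: le_trans (ctr _ _ (Uu _) (Uu _)) _.
  by rewrite ler_wpM2r ?invr_ge0.
have [l hl] := nrm_limit hu.
have Ul : U l by apply: clU => e /hl[n [? _]]; exists (u n).
exists l => //; apply: eq_of_nrm_small => e e0.
have hT n : nrm (T l - l) <= nrm (l - u n) / 2 + nrm (l - u n.+1).
  rewrite (nrmBC l (u n.+1)); apply: le_trans (nrm_sub_trans (u n.+1) _ _) _.
  by rewrite lerD2r; apply: ctr.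
have hS n : nrm (l - u n.+1) <= nrm (l - u n) + 2 * d / 2 ^+ n.
  by apply: le_trans (nrm_sub_trans (u n) _ _) _; rewrite lerD2l -addn1.
have [n [hn hd]] := hl _ (divr_gt0 e0 (ltr0n _ 4)).
by have := hT n; have := hS n; lra.
Qed.
End FixedPoint.

(** * C*-algebras *)

Section CStarTheory.
Context {R : realType} {A : cstarType R}.
Implicit Types (x y z d s e : A) (k : R[i]).
Local Notation "x ** y" := (cmul x y) (at level 40, left associativity).

Lemma cmul0l x : 0 ** x = 0.
Proof. by rewrite -{1}(scale0r (0 : A)) cmulZl scale0r. Qed.

Lemma cmul0r x : x ** 0 = 0.
Proof. by rewrite -{1}(scale0r (0 : A)) cmulZr scale0r. Qed.

Lemma cmulNl x y : (- x) ** y = - (x ** y).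
Proof. by rewrite -scaleN1r cmulZl scaleN1r. Qed.

Lemma cmulNr x y : x ** (- y) = - (x ** y).
Proof. by rewrite -scaleN1r cmulZr scaleN1r. Qed.

Lemma cmulBl x y z : (x - y) ** z = x ** z - y ** z.
Proof. by rewrite cmulDl cmulNl. Qed.

Lemma cmulBr x y z : x ** (y - z) = x ** y - x ** z.
Proof. by rewrite cmulDr cmulNr. Qed.

Lemma cstar0 : cstar (0 : A) = 0.
Proof. by rewrite -{1}(scale0r (0 : A)) cstarZ rmorph0 scale0r. Qed.

Lemma cstarN x : cstar (- x) = - cstar x.
Proof. by rewrite -scaleN1r cstarZ rmorphN rmorph1 scaleN1r. Qed.

Lemma cstarB x y : cstar (x - y) = cstar x - cstar y.
Proof. by rewrite cstarD cstarN. Qed.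

Lemma conj_realC (r : R) : Num.conj (r%:C : R[i]) = r%:C.
Proof. exact: conjc_real. Qed.

Lemma cstarZr (r : R) x : cstar (r%:C *: x) = r%:C *: cstar x.
Proof. by rewrite cstarZ conj_realC. Qed.

Lemma nrmM x y : nrm (x ** y) <= nrm x * nrm y.
Proof. by rewrite -lecR rmorphM /= -!nrmE cnormM. Qed.

Lemma nrm_cstarM x : nrm (cstar x ** x) = nrm x ^+ 2.
Proof. by apply: complexI; rewrite -nrmE cnorm_star nrmE rmorphXn. Qed.

Lemma nrm_cstar x : nrm (cstar x) = nrm x.
Proof.
suff le z : nrm z <= nrm (cstar z).
  by apply/eqP; rewrite eq_le le -{2}(cstarK x) le.
have [->|z0] := EM (z = 0); first by rewrite nrm0 nrm_ge0.
rewrite -(ler_pM2r (nrm_gt0 z0)) -expr2 -nrm_cstarM; exact: nrmM.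
Qed.

Lemma cmul_cstar_self_adjoint x : cstar (cstar x ** x) = cstar x ** x.
Proof. by rewrite cstarM cstarK. Qed.

Lemma nrm_projection_le1 (p : A) : projection p -> nrm p <= 1.
Proof.
case=> ps pp; have := nrm_cstarM p; rewrite ps pp => h.
have [->|p0] := EM (p = 0); first by rewrite nrm0 ler01.
have := nrm_gt0 p0; nra.
Qed.

Lemma nrm_projection (p : A) : projection p -> p <> 0 -> nrm p = 1.
Proof.
case=> ps pp p0; have := nrm_cstarM p; rewrite ps pp => h.
have := nrm_gt0 p0; nra.
Qed.

Lemma half_add k x : (k + k = 1) -> k *: (x + x) = x.
Proof. by move=> h; rewrite scalerDr -scalerDl h scale1r. Qed.

Let half : R[i] := (2^-1 : R)%:C.

Lemma half2 : half + half = 1.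
Proof. by rewrite -rmorphD -(rmorph1 (real_complex R)); congr (_ %:C); lra. Qed.

Lemma nrm_half x : nrm (half *: x) = nrm x / 2.
Proof. by rewrite nrmZr ger0_norm ?invr_ge0 // mulrC. Qed.

(* [1 - s] is the square root of [1 - y]; no unit is needed to state this. *)
Lemma self_adjoint_sqrt y d : cstar y = y -> nrm y <= 1 / 2 ->
  y ** d = d ** y ->
  exists s, [/\ cstar s = s, nrm s <= 1 / 2, s ** d = d ** s
              & s + s - s ** s = y].
Proof.
(* A fixed point of [T] solves [s + s - s ** s = y]. On the ball of radius 1/2, squaring does not
   increase distances, so the factor 1/2 makes [T] a contraction. The conditions in [U] are closed
   and preserved by [T]. *)
move=> ys y2 yd; pose T s := half *: (y + s ** s).
pose U := [set s : A | [/\ cstar s = s, nrm s <= 1 / 2 & s ** d = d ** s]].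
have [s [ss s2 sd] Ts] : exists2 s, U s & T s = s.
  apply: (@contraction_fixpoint _ _ T U 0).
  - by split; rewrite ?cstar0 ?nrm0 ?cmul0l ?cmul0r //; lra.
  - move=> s [ss s2 sd]; split.
    + by rewrite /T cstarZr cstarD cstarM ys ss.
    + rewrite nrm_half; have := nrmD y (s ** s); have := nrmM s s.
      have := nrm_ge0 s; nra.
    + by rewrite /T cmulZl cmulZr cmulDl cmulDr yd -cmulA sd !cmulA sd.
  - move=> x hx; split.
    + apply: eq_of_nrm_small => e e0.
      have [s [ss _ _] hs] := hx _ (divr_gt0 e0 (ltr0n _ 2)).
      apply: le_trans (nrm_sub_trans s _ _) _.
      by rewrite -{1}ss -cstarB nrm_cstar (nrmBC s); lra.
    + apply/ler_addgt0Pr => e e0; have [s [_ s2 _] hs] := hx _ e0.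
      by have := nrmD s (x - s); rewrite addrC subrK; lra.
    + apply: eq_of_nrm_small => e e0.
      have e1 : 0 < e / (2 * (nrm d + 1)).
        by rewrite divr_gt0 // mulr_gt0 // ltr_wpDl ?nrm_ge0.
      have [s [_ _ sd] hs] := hx _ e1.
      rewrite -[x ** d](subrK (s ** d)) -cmulBl sd -addrA -cmulBr.
      have h1 := nrmM (x - s) d; have h2 := nrmM d (s - x).
      apply: le_trans (nrmD _ _) _; rewrite (nrmBC s) in h2.
      have := nrm_ge0 d; move: hs; rewrite ler_pdivlMr; last first.
        by rewrite mulr_gt0 // ltr_wpDl ?nrm_ge0.
      by have := nrm_ge0 (x - s); nra.
  - move=> s t [_ s2 _] [_ t2 _]; rewrite /T -scalerBr nrm_half.
    rewrite opprD addrACA subrr add0r ler_pM2r //.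
    have -> : s ** s - t ** t = s ** (s - t) + (s - t) ** t.
      by rewrite cmulBr cmulBl addrA subrK.
    have := nrmD (s ** (s - t)) ((s - t) ** t); have := nrmM s (s - t).
    have := nrmM (s - t) t; have := nrm_ge0 (s - t); nra.
exists s; split=> //; rewrite -{1 2}Ts /T -scalerDl half2 scale1r addrK //.
Qed.

Definition is_unit e := forall x, e ** x = x /\ x ** e = x.

Lemma is_unit_cstar e : is_unit e -> cstar e = e.
Proof.
by move=> he; have := cmul_cstar_self_adjoint e; rewrite (he _).2 cstarK.
Qed.

Lemma is_unit_projection e : is_unit e -> projection e.
Proof. by move=> he; split; [exact: is_unit_cstar|exact: (he e).1]. Qed.

(** The fixed point of [l = e + s ** l] is a right inverse of [e - s]; its adjoint is a left
    inverse, so the two coincide. *)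
Lemma self_adjoint_invertible e s : is_unit e -> cstar s = s -> nrm s <= 1 / 2 ->
  exists l, [/\ cstar l = l, l ** (e - s) = e & (e - s) ** l = e].
Proof.
move=> he ss s2; pose T l := e + s ** l.
have [l _ Tl] : exists2 l, [set: A] l & T l = l.
  apply: (@contraction_fixpoint _ _ T setT 0) => // x y _ _.
  rewrite /T opprD addrACA subrr add0r -cmulBr.
  have := nrmM s (x - y); have := nrm_ge0 (x - y); nra.
have le : (e - s) ** l = e by rewrite cmulBl (he l).1 -{1}Tl /T addrK.
have el : cstar l ** (e - s) = e.
  by have := congr1 cstar le; rewrite cstarM cstarB ss (is_unit_cstar he).
have ls : cstar l = l.
  by rewrite -[LHS](he _).2 -le cmulA el (he _).1.
by exists l; split; rewrite // -{1}ls.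
Qed.

Lemma self_adjoint_sqrt_near_unit e y :
  cstar y = y -> nrm (y - e) <= 1 / 2 -> is_unit e ->
  exists k l : A, [/\ cstar k = k, cstar l = l, k ** k = y, l ** k = e & k ** l = e].
Proof.
move=> ys y2 he.
have [|||s [ss s2 _ sy]] := @self_adjoint_sqrt (e - y) 0.
- by rewrite cstarB ys is_unit_cstar.
- by rewrite nrmBC.
- by rewrite cmul0l cmul0r.
have [l [ls le el]] := self_adjoint_invertible he ss s2.
exists (e - s), l; split=> //; first by rewrite cstarB is_unit_cstar // ss.
rewrite cmulBr (he _).2 cmulBl (he _).1 opprB addrA addrAC.
apply: (@addIr _ (- e)); rewrite -[RHS]opprB -sy opprB opprD.
by rewrite [LHS]addrC -!addrA addKr [RHS]addrC -addrA.
Qed.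


(** Reduces the theorem to two facts: any nonzero [x] can be compressed close to the unit, and some
    isometry is proper. *)
Lemma purely_infinite_simple e : is_unit e -> e <> 0 ->
  (forall x, x <> 0 -> exists y, nrm (cstar (x ** y) ** (x ** y) - e) <= 1 / 2) ->
  (exists2 S, cstar S ** S = e & S ** cstar S <> e) ->
  purely_infinite A /\ cstar_simple A.
Proof.
move=> he e0 H [S SS SSe].
have he1 x : e ** x = x by have [] := he x.
have he2 x : x ** e = x by have [] := he x.
have es := is_unit_cstar he.
split; last first.
  split; first by exists e.
  move=> I [_ [I0 Ilin] Imul].
  have [[x [Ix x0]]|/forallNP nI] := EM (exists x, I x /\ x <> 0).
    right; have [y hy] := H _ x0.
    have [k [l [_ _ kk lk _]]] :=
      self_adjoint_sqrt_near_unit (cmul_cstar_self_adjoint _) hy he.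
    (* The unit is l^2 k^2, and k^2 has [x] as a factor. *)
    have Ie : I e.
      rewrite -{1}lk -[k]he1 -{1}lk -!cmulA kk.
      by do 3 apply: (Imul _ _ _).2; apply: (Imul _ _ _).1.
    by rewrite -subTset => z _; rewrite -(he1 z); apply: (Imul _ _ _).1.
  left; rewrite eqEsubset; split=> [x Ix|_ ->//] /=.
  by apply: contrapT => x0; apply: (nI x).
move=> B [_ [B0 Blin] Bmul Bstar Bher] [x Bx x0]; have [y hy] := H _ x0.
have [k [l [ks ls kk lk kl]]] :=
  self_adjoint_sqrt_near_unit (cmul_cstar_self_adjoint _) hy he.
have [u uE] : exists u, u = x ** y ** l by exists (x ** y ** l).
have uu : cstar u ** u = e.
  rewrite uE cstarM ls -cmulA (cmulA (cstar (x ** y))) -kk -cmulA kl.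
  by rewrite he2 lk.
have up w : cstar u ** (u ** w) = w by rewrite cmulA uu he1.
have up' w z : w ** cstar u ** (u ** z) = w ** z.
  by rewrite -cmulA up.
exists (u ** cstar u).
  (* Here u u^* = x h x^* is dominated by m^2 x x^*, which lies in [B]. The choice of [m] makes m^-2
     h of norm at most 1/2, so that e - m^-2 h = (e - s)^2 and the difference is the square of m (e
     - s) x^* in the sense of [cpositive]. *)
  pose h := y ** l ** cstar (y ** l).
  have hs : cstar h = h by rewrite /h cstarM cstarK.
  have [m mE] : exists m, m = 1 + 2 * nrm h by exists (1 + 2 * nrm h).
  have nh := nrm_ge0 h; have mgt0 : 0 < m by lra.
  have m0 : m != 0 by rewrite gt_eqF.
  have [|||s [ss _ _ sE]] := @self_adjoint_sqrt ((m ^- 2)%:C *: h) 0.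
  - by rewrite cstarZr hs.
  - rewrite nrmZr ger0_norm; last by rewrite invr_ge0 exprn_ge0 // ltW.
    by rewrite ler_pdivrMl ?exprn_gt0 // mE; nra.
  - by rewrite cmul0l cmul0r.
  have Bxx : B (x ** cstar x) by apply: Bmul => //; apply: Bstar.
  apply: (Bher _ ((m ^+ 2)%:C *: (x ** cstar x))).
  - by rewrite -[_ *: _]addr0; apply: Blin.
  - by exists (cstar u); rewrite cstarK.
  exists (m%:C *: (e - s) ** cstar x).
  have ee : (e - s) ** (e - s) = e - (m ^- 2)%:C *: h.
    by rewrite -sE cmulBr he2 cmulBl he1 !opprD opprK !addrA.
  have -> : u ** cstar u = x ** h ** cstar x.
    by rewrite uE /h !cstarM !cmulA.
  rewrite cstarM cstarK cstarZr cstarB es ss -!cmulA !(cmulZl, cmulZr) scalerA.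
  rewrite (cmulA (e - s)) ee cmulBl cmulBr he1 cmulZl cmulZr scalerBr scalerA.
  by rewrite /h -!rmorphM -expr2 mulfV ?expf_neq0 // scale1r -!cmulA.
split; first by split; rewrite ?cstarM ?cstarK // up'.
(* The proper isometry [S] is transported by [u]. If u S S^* u^* were u u^*, compressing by [u]
   would give S S^* = e. *)
exists (u ** S ** cstar u), (u ** (S ** cstar S) ** cstar u).
split.
- split; rewrite ?cstarM ?cstarK ?cmulA //.
  by rewrite -!cmulA !up (cmulA (cstar S)) SS he1.
- by rewrite -!cmulA up.
- move=> /(congr1 (fun z => cstar u ** z ** u)).
  by rewrite -!cmulA !up uu he2.
- by rewrite !cstarM !cstarK -!cmulA up (cmulA (cstar S)) SS he1.
- by rewrite !cstarM !cstarK -!cmulA up.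
Qed.

End CStarTheory.

(** * Boundedness of star homomorphisms *)

Section StarHomBounded.
Context {R : realType} {D A : cstarType R}.
Local Notation "x ** y" := (cmul x y) (at level 40, left associativity).
Variables (K : D -> A) (hK : star_hom K).

Lemma star_homZ k x : K (k *: x) = k *: K x.
Proof.
have [lin _ _] := hK; have K0 : K 0 = 0.
  by have := lin (-1) 0 0; rewrite !scaleN1r oppr0 addr0 addNr.
by rewrite -[k *: x]addr0 lin K0 addr0.
Qed.

Lemma star_homD x y : K (x + y) = K x + K y.
Proof. by have [lin _ _] := hK; rewrite -{1}[x]scale1r lin scale1r. Qed.

(* A self-adjoint [d] of norm at most 1/2 is the real part of the unitary
   [d + i (1 - d^2)^(1/2)], and unitaries are mapped to elements of norm at
   most 1. *)
Lemma star_hom_bounded (e : D) : is_unit e -> forall x, nrm (K x) <= 2 * nrm x.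
Proof.
move=> he; have [lin hM hs] := hK.
have es := is_unit_cstar he.
have sa2 d : cstar d = d -> nrm d <= 1 / 2 -> nrm (K d) <= 1.
  move=> ds d2; have [|||s [ss s2 sd sE]] := @self_adjoint_sqrt _ _ (d ** d) d.
  - by rewrite cstarM ds.
  - have := nrmM d d; have := nrm_ge0 d; nra.
  - by rewrite cmulA.
  pose k := e - s; have ksd : k ** d = d ** k.
    by rewrite cmulBl cmulBr (he d).1 (he d).2 sd.
  have kk : k ** k = e - d ** d.
    by rewrite -sE /k cmulBr (he _).2 cmulBl (he _).1 !opprD opprK !addrA.
  have ksa : cstar k = k by rewrite cstarB es ss.
  pose u := d + 'i *: k.
  have uu : cstar u ** u = e.
    rewrite /u cstarD cstarZ ds ksa conjCi scaleNr cmulDr !cmulDl !cmulNl.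
    rewrite !cmulZl !cmulZr scalerA kk -expr2 sqrCi scaleN1r opprK ksd.
    by rewrite addrA addrNK addrC subrK.
  have e1 : nrm (K e) <= 1.
    apply: nrm_projection_le1; split; first by rewrite -hs es.
    by rewrite -hM (he e).1.
  have Ku : nrm (K u) <= 1.
    have := nrm_cstarM (K u); rewrite -hs -hM uu => h.
    have := nrm_ge0 (K u); nra.
  have -> : d = (2^-1 : R)%:C *: (u + cstar u).
    rewrite /u cstarD cstarZ ds ksa conjCi scaleNr addrACA subrr addr0.
    by rewrite half_add // half2.
  rewrite star_homZ nrm_half star_homD hs.
  by have := nrmD (K u) (cstar (K u)); rewrite nrm_cstar; lra.
have sa d : cstar d = d -> nrm (K d) <= 2 * nrm d.
  have [->|d0] := EM (d = 0).
    by rewrite -(scale0r (0 : D)) star_homZ !scale0r !nrm0 mulr0.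
  move=> ds; have nd := nrm_gt0 d0; pose r := (2 * nrm d)^-1.
  have r0 : 0 < r by rewrite invr_gt0; lra.
  have := @sa2 (r%:C *: d); rewrite cstarZr ds star_homZ !nrmZr gtr0_norm //.
  have rd : r * (2 * nrm d) = 1 by rewrite mulVf // gt_eqF //; lra.
  have -> : r * nrm d = 1 / 2 by lra.
  move=> /(_ erefl (lexx _)) h; nra.
(* The C*-identity passes from the self-adjoint [cstar x ** x] to [x]. *)
move=> x; have := sa _ (cmul_cstar_self_adjoint x).
rewrite hM hs !nrm_cstarM; have := nrm_ge0 x; have := nrm_ge0 (K x); nra.
Qed.

End StarHomBounded.

(** * The boundary spectrum *)

Section SubsetTopology.
Local Open Scope group_scope.
Context {G : groupType}.
Implicit Types (w v : subsets G) (O : set (subsets G)).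

(** For the direct implication, the sets [O] satisfying the right-hand side form a filter, whose
    convergence to [w] can be tested one coordinate at a time. *)
Lemma nbhs_subsetsP w O : nbhs w O <->
  exists F : seq G, forall v, (forall t, t \in F -> v t = w t) -> O v.
Proof.
split; last first.
  move=> [F]; elim: F O => [|t F IH] O hO.
    by apply: filterS (@filterT _ (nbhs w) _) => v _; apply: hO.
  have h1 : nbhs w [set v : subsets G | v t = w t].
    exact: (@proj_continuous G (fun=> bool) t w [set w t]).
  have h2 := IH [set v | v t = w t -> O v].
  apply: filterS (filterI h1 (h2 _)) => [v [/= vt]|v vF vt]; first exact.
  by apply: hO => s; rewrite inE => /predU1P[->|/vF].
pose Fl : set_system (subsets G) := [set O |
  exists F : seq G, forall v, (forall t, t \in F -> v t = w t) -> O v].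
have FF : Filter Fl.
  split.
  - by exists [::].
  - move=> A B [F hF] [E hE]; exists (F ++ E) => v h; split.
      by apply: hF => t tF; apply: h; rewrite mem_cat tF.
    by apply: hE => t tE; apply: h; rewrite mem_cat tE orbT.
  - by move=> A B AB [F hF]; exists F => v /hF/AB.
suff /(_ O) : Fl --> w by exact.
apply/cvg_sup => t B; rewrite nbhsE => -[C [[D _ DC] Cw] CB].
exists [:: t] => v vt; apply: CB; move: Cw; rewrite -DC /=.
by rewrite vt // inE.
Qed.

Lemma open_eval t b : open [set w : subsets G | w t = b].
Proof.
rewrite openE => w /= wt; apply/nbhs_subsetsP; exists [:: t] => v vt /=.
by rewrite vt // inE.
Qed.

Lemma translateE t w s : translate t w s = w (t^-1 * s).
Proof. by []. Qed.

Lemma translate1 w : translate 1 w = w.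
Proof. by apply/funext => s; rewrite translateE invg1 mul1g. Qed.

Lemma translateM s t w : translate s (translate t w) = translate (s * t) w.
Proof. by apply/funext => r; rewrite !translateE invgM mulgA. Qed.

Lemma translateK t w : translate t^-1 (translate t w) = w.
Proof. by rewrite translateM mulVg translate1. Qed.

Lemma translateVK t w : translate t (translate t^-1 w) = w.
Proof. by rewrite translateM mulgV translate1. Qed.

Lemma translate_continuous t : continuous (@translate G t).
Proof.
move=> w O /nbhs_subsetsP[F hF]; apply/nbhs_subsetsP.
exists [seq t^-1 * s | s <- F] => v vw; apply: hF => s sF.
by rewrite !translateE vw // map_f.
Qed.

End SubsetTopology.

(** * Maximal directed sets and their closure *)

Section BoundarySpectrum.
Local Open Scope group_scope.
Context {G : groupType}.
Variables (P : set G) (hP : quasi_lattice_ordered P).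
Implicit Types (x y z t p : G) (w v m : subsets G) (O : set (subsets G)).
Local Notation X := (boundary_spectrum P).

Lemma qle_refl x : qle P x x.
Proof. by have [[P1 _] _ _] := hP; rewrite /qle mulVg. Qed.

Lemma qle_trans x y z : qle P x y -> qle P y z -> qle P x z.
Proof.
have [[_ PM] _ _] := hP; rewrite /qle => xy yz.
by have := PM _ _ xy yz; rewrite mulgA mulgK.
Qed.

Lemma qle_translate t x y : qle P (t * x) (t * y) <-> qle P x y.
Proof. by rewrite /qle invgM -mulgA mulKg. Qed.

Lemma hereditary_qle w x y : hereditary_subset P w -> qle P y x -> w x -> w y.
Proof. by move=> hw yx /hw/(_ yx); rewrite invgM invgK mulgA mulgV mul1g. Qed.

(** A common bound in [S] forces the join to exist and to lie below it, hence in the downward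
    closure of [S]. *)
Lemma lower_set_directed (S : set G) :
  (forall a b, S a -> S b -> exists2 c, S c & qle P a c /\ qle P b c) ->
  directed_subset P (fun y => `[< exists2 x, S x & qle P y x >]).
Proof.
move=> hS y1 y2 /asboolP[x1 Sx1 yx1] /asboolP[x2 Sx2 yx2].
have [c Sc [xc1 xc2]] := hS _ _ Sx1 Sx2.
have ub : upper_bound P y1 y2 c.
  by split; [exact: qle_trans yx1 xc1|exact: qle_trans yx2 xc2].
have [_ _ /(_ y1 y2)[|z [zub zle]]] := hP; first by exists c.
by exists z => //; apply/asboolP; exists c => //; apply: zle.
Qed.

(** Adding 1 to the list puts the bound [z] in [P]. *)
Lemma directed_bound w (l : seq G) : w 1 -> directed_subset P w ->
  (forall x, x \in l -> w x) -> exists2 z, w z & forall x, x \in 1 :: l -> qle P x z.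
Proof.
move=> w1 dw; elim: l => [|a l IH] hl.
  by exists 1 => // x; rewrite inE => /eqP ->; exact: qle_refl.
have [z wz hz] : exists2 z, w z & forall x, x \in 1 :: l -> qle P x z.
  by apply: IH => x xl; apply: hl; rewrite inE xl orbT.
have [|c [[ac zc] _] wc] := dw a z _ wz; first by apply: hl; rewrite mem_head.
exists c => // x; rewrite !inE => /or3P[/eqP->|/eqP->//|xl].
  by apply: qle_trans zc; apply: hz; rewrite mem_head.
by apply: qle_trans zc; apply: hz; rewrite inE xl orbT.
Qed.

Lemma maximal_directed_exists : exists m, maximal_directed P m.
Proof.
(* Adjoining 1 builds membership of 1 into the family to which Zorn's lemma applies, even for the
   union of an empty chain. *)
pose D (S : set G) : subsets G := fun x => `[< S x \/ x = 1 >].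
have [F FD Ftot|S [SD Smax]] := @Zorn_bigcup G (fun S => directed_subset P (D S)).
  have J S x y : F S -> D S x -> D S y ->
      exists2 z, is_join P x y z & D (\bigcup_(X in F) X) z.
    move=> FS Sx Sy; have [z jz /asboolP Sz] := FD _ FS _ _ Sx Sy.
    by exists z => //; apply/asboolP; case: Sz => [Sz|]; [left; exists S|right].
  have inD (S : set G) x : S x -> D S x by move=> ?; apply/asboolP; left.
  have D1 (S : set G) : D S 1 by apply/asboolP; right.
  move=> x y /asboolP[[S FS Sx]|->] /asboolP[[T FT Ty]|->].
  - have [ST|TS] := Ftot _ _ FS FT.
      by apply: (J T) => //; apply: inD => //; apply: ST.
    by apply: (J S) => //; apply: inD => //; apply: TS.
  - by apply: (J S) => //; apply: inD.
  - by apply: (J T) => //; apply: inD.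
  - exists 1; last exact: D1.
    by do 2?split; try exact: qle_refl; move=> w [].
exists (D S); split=> //; first by apply/asboolP; right.
move=> v dv Sv; have v1 : v 1 by apply: Sv; apply/asboolP; right.
have Dv : D [set x | v x] = v.
  apply/funext => x; apply/idP/idP => [/asboolP[//|->//]|vx].
  by apply/asboolP; left.
have Svs : S `<=` [set x | v x] by move=> x Sx; apply: Sv; apply/asboolP; left.
have [vS|nvS] := EM ([set x | v x] `<=` S).
  by rewrite -Dv; congr D; apply/seteqP.
by exfalso; apply: (Smax [set x | v x]); [split|rewrite Dv].
Qed.

(** The downward closure of [m] is directed and contains [m], so by maximality it is [m]; heredity
    follows. *)
Lemma maximal_directed_nica m : maximal_directed P m -> nica_spectrum P m.
Proof.
case=> m1 dm mmax; pose v : subsets G := fun y => `[< exists2 x, m x & qle P y x >].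
have vm : v = m.
  apply: mmax => [|x mx]; last by apply/asboolP; exists x => //; exact: qle_refl.
  apply: (@lower_set_directed [set x | m x]) => a b ma mb.
  by have [c [cub _] mc] := dm _ _ ma mb; exists c.
split=> // x p mx Pp; rewrite -vm; apply/asboolP; exists x => //.
by rewrite /qle invgM invgK mulgVK.
Qed.

Lemma maximal_directed_boundary m : maximal_directed P m -> X m.
Proof.
by move=> mm; split; [exact: maximal_directed_nica|exact: subset_closure].
Qed.

Lemma boundary1 w : X w -> w 1.
Proof. by case=> -[]. Qed.

(** Otherwise [t] has a join with every member of [m]. The downward closure of these joins is
    directed and contains both [m] and [t], against maximality. *)
Lemma maximal_directed_separates m t : maximal_directed P m -> ~ m t ->
  exists2 r, m r & forall z, ~ upper_bound P r t z.
Proof.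
case=> m1 dm mmax mt; apply: contrapT => /forall2NP h.
have [_ _ hjoin] := hP.
have ub r : m r -> exists z, is_join P r t z.
  by move=> mr; case: (h r) => // /existsNP[z /contrapT rtz]; apply: hjoin; exists z.
pose S := [set j | exists2 r, m r & is_join P r t j].
have vm : (fun y => `[< exists2 x, S x & qle P y x >]) = m.
  apply: mmax => [|r mr].
    apply: lower_set_directed => a b [r mr [[ra ta] amin]] [s ms [[sb tb] bmin]].
    have [q [[rq sq] _] mq] := dm _ _ mr ms.
    have [j jj] := ub _ mq; have [[qj tj] _] := jj; exists j; first by exists q.
    by split; [apply: amin|apply: bmin]; split=> //; apply: qle_trans qj.
  have [j jj] := ub _ mr; apply/asboolP; exists j; first by exists r.
  by case: jj => -[].
apply: mt; rewrite -vm; apply/asboolP; have [j jj] := ub _ m1.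
by exists j; [exists 1|case: jj => -[]].
Qed.

Lemma is_join_translate t x y z :
  is_join P (t^-1 * x) (t^-1 * y) z -> is_join P x y (t * z).
Proof.
have le a b : qle P (t^-1 * a) b <-> qle P a (t * b).
  by rewrite -(qle_translate t) mulgA mulgV mul1g.
move=> [[xz yz] zmin]; split; first by split; apply/le.
move=> u [xu yu]; have /zmin : upper_bound P (t^-1 * x) (t^-1 * y) (t^-1 * u).
  by split; apply/qle_translate.
by rewrite -{1}(qle_translate t) (mulgA t t^-1 u) mulgV mul1g.
Qed.

Lemma directed_translate t w : directed_subset P w ->
  directed_subset P (translate t w).
Proof.
move=> dw x y wx wy; have [z jz wz] := dw _ _ wx wy.
by exists (t * z); [exact: is_join_translate|rewrite translateE mulKg].
Qed.

Lemma maximal_directed_translate t m : maximal_directed P m -> m t ->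
  maximal_directed P (translate t^-1 m).
Proof.
case=> m1 dm mmax mt; split; first by rewrite translateE invgK mulg1.
  exact: directed_translate.
move=> v dv mv; rewrite -(translateK t v) (mmax (translate t v)) //.
  exact: directed_translate.
by move=> x mx; rewrite translateE; apply: mv; rewrite translateE invgK mulgA mulgV mul1g.
Qed.

(** Translation maps maximal directed sets containing [t] to maximal directed sets; by continuity
    this passes to the closure. *)
Lemma boundary_translateV t w : X w -> w t -> X (translate t^-1 w).
Proof.
case=> -[w1 hw dw] clw wt; split.
  split; first by rewrite translateE invgK mulg1.
    by move=> x p wx Pp; rewrite translateE mulgA; apply: hw.
  exact: directed_translate.
move=> O nO; have Ot : nbhs w (translate t^-1 @^-1` O) by exact: translate_continuous.
have wt' := open_nbhs_nbhs (conj (open_eval t true) wt).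
have [m [mm [/= Om mt]]] := clw _ (filterI Ot wt').
by exists (translate t^-1 m); split=> //; apply: maximal_directed_translate.
Qed.

Lemma boundary_translate p w : X w -> P p -> X (translate p w).
Proof.
move=> Xw Pp; rewrite -[p]invgK; apply: boundary_translateV => //.
by have [[w1 hw _] _] := Xw; have := hw _ _ w1 Pp; rewrite mul1g.
Qed.

(* The key property of the boundary: a maximal set in [O] excludes an element
   [t] only because one of its members has no upper bound in common with
   [t]. *)
Lemma boundary_base O : open O -> O `&` X !=set0 ->
  exists p, [/\ P p, exists2 w, X w & w p & forall w, X w -> w p -> O w].
Proof.
move=> oO [w [Ow [_ clw]]].
have [m [mm Om]] := clw _ (open_nbhs_nbhs (conj oO Ow)).
have [m1 dm _] := mm.
have /nbhs_subsetsP[F hF] : nbhs m O by exact: open_nbhs_nbhs.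
have [r hr] : exists r, m r /\ forall v, X v -> v r -> forall t, t \in F -> v t = m t.
  elim: F {hF} => [|t F [r [mr IH]]]; first by exists 1.
  (* One member [s] of [m] decides the coordinate [t]: either [t] itself, by heredity, or an element
     that no directed set contains together with [t]. *)
  have [s [ms hs]] : exists s, m s /\ forall v, X v -> v s -> v t = m t.
    have [mt|/negP mt] := boolP (m t); first by exists t.
    have [s ms hs] := maximal_directed_separates mm mt.
    exists s; split=> // v [[_ _ dv] _] vs; apply/negP => vt.
    by have [z [zub _] _] := dv _ _ vs vt; apply: hs zub.
  have [z [[rz sz] _] mz] := dm _ _ mr ms; exists z; split=> // v Xv vz.
  have [[_ hv _] _] := Xv.
  move=> u; rewrite inE => /predU1P[->|uF].
    by apply: hs => //; apply: hereditary_qle sz _.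
  by apply: IH => //; apply: hereditary_qle rz _.
have [p mp hp] : exists2 z, m z & forall x, x \in [:: 1; r] -> qle P x z.
  by apply: directed_bound => // x; rewrite inE => /eqP->; case: hr.
exists p; split.
- by have := hp 1; rewrite mem_head /qle invg1 mul1g; apply.
- by exists m => //; apply: maximal_directed_boundary.
- move=> v Xv vp; apply: hF => t tF; apply: hr.2 => //.
  have [[_ hv _] _] := Xv; apply: hereditary_qle vp => //.
  by apply: hp; rewrite !inE eqxx orbT.
Qed.

(** * Consequences of topological freeness *)

Section TopologicallyFree.
Hypothesis hfree : topologically_free X.

(** The elements of [F] are treated one by one. Freeness provides a point of [O] at which [t] does
    not act or which it moves; fixing the coordinate [t^-1], or two coordinates that witness the
    move, gives a neighbourhood disjoint from its translate. *)
Lemma free_shrink (F : seq G) O : 1 \notin F -> open O -> O `&` X !=set0 ->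
  exists W, [/\ open W, W `<=` O, W `&` X !=set0 &
    forall t w, t \in F -> W w -> X w -> w t^-1 -> ~ W (translate t w)].
Proof.
elim: F O => [|t F IH] O F1 oO neO; first by exists O; split.
have t1 : t <> 1 by move=> t1; rewrite t1 mem_head in F1.
have [w [[Ow Xw] hw]] : exists w, (O w /\ X w) /\ ~ (w t^-1 /\ translate t w = w).
  apply: contrapT => /forallNP h; case: neO => w [Ow Xw].
  have : O `&` X = set0.
    apply: (hfree t1 oO) => v OXv; apply: contrapT => hv.
    by apply: (h v); split.
  by rewrite -subset0 => /(_ w); apply.
have [U [oU Uw hU]] : exists U, [/\ open U, U w &
    forall v, U v -> v t^-1 -> ~ U (translate t v)].
  have [wt|wt] := boolP (w t^-1); last first.
    exists [set v : subsets G | v t^-1 = false]; split; first exact: open_eval.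
      exact: negbTE.
    by move=> v /= ->.
  have [s hs] : exists s, w (t^-1 * s) <> w s.
    by apply/existsNP => h; apply: hw; split=> //; apply/funext => s; apply: h.
  exists ([set v : subsets G | v (t^-1 * s) = w (t^-1 * s)] `&`
          [set v : subsets G | v s = w s]).
  split=> //; first by apply: openI; exact: open_eval.
  by move=> v [/= v1 _] _ [_]; rewrite /= translateE v1.
have [|||W [oW WO neW hW]] := IH (O `&` U).
- by apply: contra F1; rewrite inE orbC => ->.
- exact: openI.
- by exists w.
exists W; split=> // [v /WO[]//|s v]; rewrite inE => /predU1P[->|sF].
  by move=> /WO[_ Uv] _ vt /WO[_]; apply: hU.
exact: hW.
Qed.

Lemma boundary_free_base (F : seq G) O : open O -> O `&` X !=set0 ->
  exists p, [/\ P p, exists2 w, X w & w p, forall w, X w -> w p -> O w &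
    forall t w, t \in F -> t <> 1 -> X w -> w p -> w t^-1 ->
      ~ translate t w p].
Proof.
move=> oO neO.
have F1 : 1 \notin [seq t <- F | t != 1] by rewrite mem_filter eqxx.
have [W [oW WO neW hW]] := free_shrink F1 oO neO.
have [p [Pp pne hp]] := boundary_base oW neW.
exists p; split=> // [w Xw wp|t w tF /eqP t1 Xw wp wt twp].
  by apply: WO; apply: hp.
apply: (hW t w) => //; first by rewrite mem_filter t1.
  exact: hp.
apply: hp twp; rewrite -[t]invgK; exact: boundary_translateV.
Qed.

(** If every point of [X] contained all of [P], any two points would coincide by directedness and
    heredity. The single point would then be fixed by a nontrivial [t] in [P], against freeness. *)
Lemma boundary_proper : P <> [set 1] -> exists t w, [/\ P t, X w & ~ w t].
Proof.
move=> P1; apply: contrapT => h.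
have hall t w : P t -> X w -> w t.
  by move=> Pt Xw; apply: contrapT => wt; apply: h; exists t, w.
have [t Pt t1] : exists2 t, P t & t <> 1.
  apply: contrapT => /forall2NP ht; apply: P1; apply/seteqP; split=> [x Px|_ ->].
    by case: (ht x) => // /contrapT.
  by have [[]] := hP.
have sub w v x : X w -> X v -> w x -> v x.
  move=> Xw Xv wx; have [[w1 _ dw] _] := Xw; have [[_ hv _] _] := Xv.
  have [p [[xp p1] _] _] := dw _ _ wx w1.
  apply: hereditary_qle xp _ => //; apply: hall => //.
  by move: p1; rewrite /qle invg1 mul1g.
have [m /maximal_directed_boundary Xm] := maximal_directed_exists.
have : setT `&` X = set0.
  apply: (hfree t1 openT) => w [_ Xw]; split.
    by have [[w1 hw _] _] := Xw; have := hw _ _ w1 Pt; rewrite mul1g.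
  have Xtw := boundary_translate Xw Pt.
  by apply/funext => x; apply/idP/idP; apply: sub.
by rewrite -subset0 => /(_ m); apply.
Qed.

End TopologicallyFree.
End BoundarySpectrum.

(** * Finite sums and their representations *)

Section ContinuousFunctions.
Context {R : realType} {G : groupType}.
Variable X : set (subsets G).
Implicit Types (f g : subsets G -> R[i]) (w v : subsets G) (k : R[i]).

Definition continuous_on f : Prop := forall w, X w ->
  (f v : R[i]^o) @[v --> within X (nbhs w)] --> (f w : R[i]^o).

Lemma C0_UP t f :
  C0_U X t f <-> continuous_on f /\ (forall w, ~ (X w /\ w t) -> f w = 0).
Proof. by rewrite /C0_U subspace_continuousP. Qed.

Lemma near_eq_continuous_on f g w :
  (\forall v \near within X (nbhs w), g v = f v) -> X w ->
  (f v : R[i]^o) @[v --> within X (nbhs w)] --> (f w : R[i]^o) ->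
  (g v : R[i]^o) @[v --> within X (nbhs w)] --> (g w : R[i]^o).
Proof.
move=> gf Xw fw; have gfw : g w = f w.
  by move: gf; rewrite near_withinE => /nbhs_singleton; apply.
rewrite gfw; apply: cvg_trans fw; apply: near_eq_cvg.
by apply: filterS gf => v ->.
Qed.

Lemma continuous_on_cst k : continuous_on (fun=> k).
Proof. by move=> w _; apply: cvg_cst. Qed.

Lemma continuous_onD f g : continuous_on f -> continuous_on g ->
  continuous_on (fun w => f w + g w).
Proof. by move=> cf cg w Xw; apply: cvgD; [exact: cf|exact: cg]. Qed.

Lemma continuous_onM f g : continuous_on f -> continuous_on g ->
  continuous_on (fun w => f w * g w).
Proof.
move=> cf cg w Xw; exact: (@cvgM R[i] _ _ _ f g _ _ (cf _ Xw) (cg _ Xw)).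
Qed.

Lemma continuous_on_sum (I : Type) (l : seq I) (F : I -> subsets G -> R[i]) :
  (forall s, continuous_on (F s)) -> continuous_on (fun w => \sum_(s <- l) F s w).
Proof.
move=> cF; elim: l => [|s l IH].
  under [X in continuous_on X]funext do rewrite big_nil.
  exact: continuous_on_cst.
under [X in continuous_on X]funext do rewrite big_cons.
exact: (continuous_onD (cF s) IH).
Qed.

Lemma continuous_on_conj f : continuous_on f -> continuous_on (fun w => Num.conj (f w)).
Proof.
move=> cf w Xw; have := cf w Xw => /cvgrPdist_lt h.
apply/cvgrPdist_lt => e e0; apply: filterS (h _ e0) => v.
by rewrite -rmorphB norm_conjC.
Qed.

Lemma continuous_on_eval t : continuous_on (fun w => if w t then 1 else 0).
Proof.
move=> w Xw.
apply: (@near_eq_continuous_on (fun=> if w t then 1 else 0)) => //; last first.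
  exact: cvg_cst.
apply: cvg_within; apply/nbhs_subsetsP; exists [:: t] => v vt.
by rewrite vt // inE.
Qed.

(** The indicator function of U_t n X, continuous on [X] because U_t is clopen. The test for [X]
    follows the convention of extending by 0. *)
Definition chi (t : G) : subsets G -> R[i] := fun w => if `[< X w >] && w t then 1 else 0.

Lemma chi_in t w : X w -> w t -> chi t w = 1.
Proof. by move=> Xw wt; rewrite /chi asboolT // wt. Qed.

Lemma chi_C0_U t : C0_U X t (chi t).
Proof.
apply/C0_UP; split=> [w Xw|w nw]; last first.
  by rewrite /chi; case: ifPn => // /andP[/asboolP Xw wt]; case: nw.
apply: (@near_eq_continuous_on (fun w => if w t then 1 else 0) (chi t) w _ Xw).
  by rewrite near_withinE; apply: nearW => v /= Xv; rewrite /chi asboolT.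
exact: continuous_on_eval.
Qed.

(** Turns a real function [f] with values in [-1, 1] into the imaginary part of a unitary whose real
    part is [f]. *)
Definition cos_to_sin (z : R[i]) : R[i] := (Num.sqrt (1 - complex.Re z ^+ 2))%:C.

Lemma cos_to_sin_continuous :
  continuous (cos_to_sin : R[i]^o -> R[i]^o).
Proof.
have cRe : continuous ((fun z => complex.Re z) : R[i]^o -> R^o).
  move=> z; apply/(@cvgrPdist_lt R R^o _ (nbhs (z : R[i]^o)) (nbhs_filter _)) => e e0.
  have e0C : 0 < (e%:C : R[i]) by rewrite ltcR.
  have /(@cvgrPdist_lt _ R[i]^o _ _ (nbhs_filter _))/(_ _ e0C) :=
    @cvg_id _ (nbhs (z : R[i]^o)).
  apply: filterS => y /=; rewrite -ltcR; apply: le_lt_trans.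
  by have := normc_ge_Re (z - y); rewrite raddfB.
have cC : continuous ((fun x => x%:C) : R^o -> R[i]^o).
  move=> x; apply/(@cvgrPdist_lt _ R[i]^o _ (nbhs (x : R^o)) (nbhs_filter _)) => e e0.
  have eE : e = (complex.Re e)%:C by rewrite RRe_real // gtr0_real.
  have e0' : 0 < complex.Re e by rewrite -ltcR -eE.
  have /(@cvgrPdist_lt R R^o _ _ (nbhs_filter _))/(_ _ e0') := @cvg_id _ (nbhs (x : R^o)).
  apply: filterS => y /=; rewrite -rmorphB /= normc_def /= expr0n addr0 sqrtr_sqr.
  by rewrite eE ltcR.
pose q (z : R[i]^o) : R^o := 1 - complex.Re z ^+ 2.
pose r (x : R^o) : R[i]^o := x%:C.
have cq : continuous q.
  move=> z; apply: (@cvgB R R^o _ _ (nbhs_filter (z : R[i]^o)) (fun=> 1)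
    (fun z => complex.Re z ^+ 2)).
    exact: (@cvg_cst R^o).
  under eq_fun do rewrite expr2.
  exact: (@cvgM R _ _ (nbhs_filter (z : R[i]^o)) _ _ _ _ (cRe z) (cRe z)).
move=> z; apply: (@continuous_comp _ _ _ q (r \o (@Num.sqrt R : R^o -> R^o))).
  exact: cq.
apply: (@continuous_comp _ _ _ (@Num.sqrt R : R^o -> R^o) r).
  exact: sqrt_continuous.
exact: cC.
Qed.

Lemma continuous_on_cos_to_sin f : continuous_on f ->
  continuous_on (fun w => cos_to_sin (f w)).
Proof.
move=> cf w Xw; exact: cvg_comp (cf _ Xw) (@cos_to_sin_continuous _).
Qed.

End ContinuousFunctions.

(** * The convolution algebra of finite sums *)

Section FiniteSums.
Context {R : realType} {G : groupType}.
Variable X : set (subsets G).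
Hypothesis X1 : forall w, X w -> w 1%g.
Hypothesis XV : forall t w, X w -> w t -> X (translate t^-1%g w).
Local Notation fsum := (G -> subsets G -> R[i]).
Implicit Types (a b : fsum) (f g : subsets G -> R[i]) (w v : subsets G)
  (k : R[i]) (s t r p : G).

Lemma C0_U_out t f w : C0_U X t f -> f w != 0 -> X w /\ w t.
Proof.
by move=> /C0_UP[_ f0] fw; apply: contrapT => /f0 h; rewrite h eqxx in fw.
Qed.

Lemma alphaE t f w : alpha t f w = if w t then f (translate t^-1%g w) else 0.
Proof. by []. Qed.

Lemma alpha_continuous_on t f : continuous_on X f -> continuous_on X (alpha t f).
Proof.
move=> cf w Xw; have [wt|wt] := boolP (w t).
  apply: (@near_eq_continuous_on _ _ _ (fun v => f (translate t^-1%g v))) => //.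
    apply: cvg_within; apply/nbhs_subsetsP; exists [:: t] => v vt.
    by rewrite alphaE vt ?inE // wt.
  have wt' := cf _ (XV Xw wt).
  apply: cvg_trans wt'.
  apply: (@cvg_app _ _ (translate t^-1%g @ within X (nbhs w))
     (within X (nbhs (translate t^-1%g w))) f).
  move=> O hO.
  have h1 : nbhs w [set v | X (translate t^-1%g v) -> O (translate t^-1%g v)].
    exact: (@translate_continuous _ t^-1%g w _ hO).
  have h2 : nbhs w [set v : subsets G | v t].
    by apply/nbhs_subsetsP; exists [:: t] => v /= ->; rewrite ?inE.
  have h3 : nbhs w [set v | X v -> O (translate t^-1%g v)].
    by apply: filterS (filterI h1 h2) => v [/= Ov vt] Xv; apply: Ov; apply: XV.
  exact: h3.
apply: (@near_eq_continuous_on _ _ _ (fun=> 0)) => //; last exact: cvg_cst.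
apply: cvg_within; apply/nbhs_subsetsP; exists [:: t] => v vt.
by rewrite alphaE vt ?inE // (negbTE wt).
Qed.

Definition supp_in (F : seq G) a := forall s, s \notin F -> forall w, a s w = 0.

Lemma finite_sum_supp a : finite_sum X a -> exists2 F, uniq F & supp_in F a.
Proof.
case=> _ /finite_seqP[F hF]; exists (undup F); first exact: undup_uniq.
move=> s sF w; apply: contrapT => asw; move: sF; rewrite mem_undup => /negP; apply.
by suff : [set` F] s by []; rewrite -hF; exists w.
Qed.

Lemma finite_sumP a : (forall t, C0_U X t (a t)) -> (exists F, supp_in F a) ->
  finite_sum X a.
Proof.
move=> ha [F hF]; split=> //; apply: sub_finite_set (finite_seq F) => s [w asw].
by apply: contrapT => /negP sF; apply: asw; apply: hF.
Qed.

(** As [a s] vanishes off U_s, the two nested [alpha] cancel and leave the usual convolution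
    formula. *)
Lemma fs_mulE a b (F : seq G) r w : (forall t, C0_U X t (a t)) ->
  supp_in F a -> uniq F ->
  fs_mul a b r w = \sum_(s <- F) a s w * b (s^-1 * r)%g (translate s^-1%g w).
Proof.
move=> ca hF uF; rewrite /fs_mul.
have E s : alpha s (fun v => alpha s^-1%g (a s) v * b (s^-1 * r)%g v) w =
    a s w * b (s^-1 * r)%g (translate s^-1%g w).
  rewrite !alphaE translateK translateE invgK mulgV.
  have [->|nz] := eqVneq (a s w) 0; first by rewrite !mul0r if_same mul0r if_same.
  by have [/X1 -> ->] := C0_U_out (ca s) nz.
under eq_fsbigr do rewrite E.
rewrite (@fsbigE _ _ _ _ _ F) //; last by move=> s _ sF; rewrite hF ?mul0r.
by apply: eq_bigl => s; rewrite in_setT.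
Qed.

Lemma fs_starE a r w : (forall t, C0_U X t (a t)) ->
  fs_star a r w = Num.conj (a r^-1%g (translate r^-1%g w)).
Proof.
move=> ca; rewrite /fs_star alphaE; case: ifPn => // wr.
have [->|nz] := eqVneq (a r^-1%g (translate r^-1%g w)) 0; first by rewrite conjC0.
have [/X1] := C0_U_out (ca _) nz; rewrite translateE invgK mulg1 => wr'.
by rewrite wr' in wr.
Qed.

Lemma finite_sum_mul a b : finite_sum X a -> finite_sum X b -> finite_sum X (fs_mul a b).
Proof.
move=> fa fb; have [F uF hF] := finite_sum_supp fa.
have [E _ hE] := finite_sum_supp fb; have [ca _] := fa; have [cb _] := fb.
have mE r w := fs_mulE b r w ca hF uF.
apply: finite_sumP => [r|].
  apply/C0_UP; split=> [|w nw].
    (* The plain translate is replaced by [alpha s], which agrees with it where [a s] is nonzero and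
       preserves continuity on [X]. *)
    have -> : fs_mul a b r = fun w => \sum_(s <- F) a s w * alpha s (b (s^-1 * r)%g) w.
      apply/funext => w; rewrite mE; apply: eq_bigr => s _; rewrite alphaE.
      have [->|nz] := eqVneq (a s w) 0; first by rewrite !mul0r.
      by have [_ ->] := C0_U_out (ca s) nz.
    apply: continuous_on_sum => s; apply: continuous_onM.
      by have /C0_UP[] := ca s.
    by apply: alpha_continuous_on; have /C0_UP[] := cb (s^-1 * r)%g.
  rewrite mE big1 // => s _; apply/eqP; rewrite mulf_eq0; apply: contrapT.
  move=> /negP; rewrite negb_or => /andP[nz1 nz2]; apply: nw.
  have [Xw _] := C0_U_out (ca s) nz1; have [_] := C0_U_out (cb _) nz2.
  by rewrite translateE invgK mulgA mulgV mul1g.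
exists [seq (s * t)%g | s <- F, t <- E] => r hr w; rewrite mE big1_seq // => s /= sF.
rewrite hE ?mulr0 //; apply: contra hr => tE; apply/allpairsP.
by exists (s, s^-1 * r)%g; split=> //=; rewrite mulgA mulgV mul1g.
Qed.

Lemma finite_sum_star a : finite_sum X a -> finite_sum X (fs_star a).
Proof.
move=> fa; have [F _ hF] := finite_sum_supp fa; have [ca _] := fa.
apply: finite_sumP => [r|].
  apply/C0_UP; split=> [|w nw].
    apply: alpha_continuous_on; apply: continuous_on_conj.
    by have /C0_UP[] := ca r^-1%g.
  rewrite fs_starE //; apply/eqP; rewrite conjC_eq0; apply: contrapT => /negP nz.
  apply: nw; have [Xw] := C0_U_out (ca _) nz.
  rewrite translateE invgK mulgV => w1; move/X1: (Xw).
  rewrite translateE invgK mulg1 => wr; split=> //.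
  have := @XV r^-1%g _ Xw; rewrite invgK translateVK; apply.
  by rewrite translateE invgK mulgV.
exists [seq s^-1%g | s <- F] => r hr w; rewrite fs_starE // hF ?conjC0 //.
by apply: contra hr => rF; rewrite -[r]invgK map_f.
Qed.

Lemma finite_sum_lin k a b : finite_sum X a -> finite_sum X b ->
  finite_sum X (fs_lin k a b).
Proof.
move=> fa fb; have [F _ hF] := finite_sum_supp fa.
have [E _ hE] := finite_sum_supp fb; have [ca _] := fa; have [cb _] := fb.
apply: finite_sumP => [r|].
  have /C0_UP[ca1 ca2] := ca r; have /C0_UP[cb1 cb2] := cb r.
  apply/C0_UP; split=> [|w nw]; last by rewrite /fs_lin ca2 // cb2 // mulr0 addr0.
  exact: (continuous_onD (continuous_onM (@continuous_on_cst _ _ X k) ca1) cb1).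
exists (F ++ E) => r; rewrite mem_cat negb_or => /andP[rF rE] w.
by rewrite /fs_lin hF // hE // mulr0 addr0.
Qed.

(** The element f delta_t. *)
Definition single f t : fsum := fun s w => if s == t then f w else 0.

Lemma supp_single f t : supp_in [:: t] (single f t).
Proof. by move=> s; rewrite inE /single => /negbTE ->. Qed.

Lemma C0_U_single f t s : C0_U X t f -> C0_U X s (single f t s).
Proof.
move=> cf; rewrite /single; have [->//|_] := eqVneq s t.
by apply/C0_UP; split=> //; exact: continuous_on_cst.
Qed.

Lemma finite_sum_single f t : C0_U X t f -> finite_sum X (single f t).
Proof.
move=> cf; apply: finite_sumP => [s|]; first exact: C0_U_single.
by exists [:: t]; exact: supp_single.
Qed.

Lemma fs_mul_singlel f t b r w : C0_U X t f ->
  fs_mul (single f t) b r w = f w * b (t^-1 * r)%g (translate t^-1%g w).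
Proof.
move=> cf; rewrite (fs_mulE _ _ _ _ (@supp_single f t)) //.
  by rewrite big_seq1 /single eqxx.
by move=> s; apply: C0_U_single.
Qed.

Lemma fs_mul_singler a g t r w : finite_sum X a ->
  fs_mul a (single g t) r w =
  a (r * t^-1)%g w * g (translate (r * t^-1)^-1%g w).
Proof.
move=> fa; have [F _ hF] := finite_sum_supp fa; have [ca _] := fa.
pose E := undup ((r * t^-1)%g :: F).
have hE : supp_in E a.
  by move=> s; rewrite mem_undup inE negb_or => /andP[_ sF]; apply: hF.
rewrite (fs_mulE _ _ _ _ hE) ?undup_uniq //.
rewrite (bigD1_seq (r * t^-1)%g) ?undup_uniq ?mem_undup ?mem_head //=.
rewrite /single invgM invgK mulgVK eqxx big1 ?addr0 // => s st.
rewrite [_ == t]negbTE ?mulr0 //; apply: contra st => /eqP <-.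
by rewrite invgM invgK mulgA mulgV mul1g.
Qed.

Lemma fs_star_single g t : C0_U X t g ->
  fs_star (single g t) = single (fun w => Num.conj (g (translate t w))) t^-1%g.
Proof.
move=> cg; apply/funext => r; apply/funext => w; rewrite fs_starE; last first.
  by move=> s; apply: C0_U_single.
rewrite /single (can2_eq invgK invgK).
by have [->|_] := eqVneq r t^-1%g; rewrite ?invgK ?conjC0.
Qed.

Local Notation unit1 := (single (chi X 1%g) 1%g).

Lemma C0_U1_out f w : C0_U X 1%g f -> f w = chi X 1%g w * f w.
Proof.
move=> cf; have [->|/(C0_U_out cf)[Xw w1]] := eqVneq (f w) 0; first by rewrite mulr0.
by rewrite chi_in // mul1r.
Qed.

Lemma fs_mul1l a : finite_sum X a -> fs_mul unit1 a = a.
Proof.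
move=> [ca _]; apply/funext => r; apply/funext => w.
rewrite fs_mul_singlel; last exact: chi_C0_U.
rewrite invg1 mul1g translate1.
have [->|/(C0_U_out (ca r))[Xw _]] := eqVneq (a r w) 0; first by rewrite mulr0.
by rewrite chi_in ?mul1r // X1.
Qed.

Lemma fs_mul1r a : finite_sum X a -> fs_mul a unit1 = a.
Proof.
move=> fa; have [ca _] := fa; apply/funext => r; apply/funext => w.
rewrite fs_mul_singler // invg1 mulg1.
have [->|/(C0_U_out (ca r))[Xw wr]] := eqVneq (a r w) 0; first by rewrite mul0r.
by have Xr := XV Xw wr; rewrite chi_in ?mulr1 //; apply: X1.
Qed.

(** The coefficient of a^* a at 1 is a sum of squared moduli. *)
Lemma fs_star_mul1 a w : finite_sum X a ->
  0 <= fs_mul (fs_star a) a 1%g w.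
Proof.
move=> fa; have fs := finite_sum_star fa; have [F uF hF] := finite_sum_supp fs.
have [ca _] := fa; have [cs _] := fs; rewrite (fs_mulE _ _ _ cs hF uF).
by apply: sumr_ge0 => s _; rewrite fs_starE // mulg1 mulrC mul_conjC_ge0.
Qed.

(* [p] for which [translate p] maps all of [X] into [X], so that
   [chi p delta_p] is an isometry; this is the case for all positive [p]. *)
Definition total_at p := forall w, X w -> X (translate p w) /\ w p^-1%g.

(** * Compression by the isometries chi_p delta_p *)

Section Compression.
Variable p : G.
Hypothesis hp : total_at p.
Local Notation iso := (single (chi X p) p).

(** Every point of [X] contains [p^-1], so the indicator of [X] is an admissible coefficient at
    [p^-1]. *)
Lemma total_at_C0_U : C0_U X p^-1%g (chi (R := R) X 1%g).
Proof.
have /C0_UP[c _] := @chi_C0_U R _ X 1%g; apply/C0_UP; split=> // w nw.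
rewrite /chi; case: ifPn => // /andP[/asboolP Xw _].
by case: nw; split=> //; have [] := hp Xw.
Qed.

Lemma fs_star_iso : fs_star iso = single (chi X 1%g) p^-1%g.
Proof.
rewrite fs_star_single; last exact: chi_C0_U.
congr single; apply/funext => w; rewrite /chi translateE mulVg.
have [w1|w1] := boolP (w 1%g); rewrite ?andbF ?conjC0 // !andbT.
have [Xw|nX] := pselect (X w).
  by have [Xpw _] := hp Xw; rewrite !asboolT // conjC1.
rewrite [in RHS]asboolF // asboolF ?conjC0 // => Xpw; apply: nX.
by have := @XV p _ Xpw; rewrite translateK; apply; rewrite translateE mulVg.
Qed.

Lemma chi_translate w : chi (R := R) X 1%g w * chi X p (translate p w) = chi X 1%g w.
Proof.
have [->|/(C0_U_out (@chi_C0_U _ _ _ _))[Xw w1]] := eqVneq (chi X 1%g w) (0 : R[i]).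
  by rewrite mul0r.
by rewrite [chi X p _]chi_in ?mulr1 //; [have [] := hp Xw|rewrite translateE mulVg].
Qed.

Lemma iso_isometry : fs_mul (fs_star iso) iso = unit1.
Proof.
apply/funext => r; apply/funext => w; rewrite fs_star_iso.
rewrite fs_mul_singlel; last exact: total_at_C0_U.
rewrite invgK /single -[X in _ == X]mulg1 (inj_eq (@mulgI _ p)).
by case: eqP => _; rewrite ?mulr0 ?chi_translate.
Qed.

(** The coefficient at [r] of the compression is that of [b] at t = p r p^-1, read at points that
    contain [p] and whose translate by t^-1 also contains [p]. The last hypothesis excludes such
    points unless t = 1. *)
Lemma compressionE b (F : seq G) : finite_sum X b -> supp_in F b ->
  (forall t w, t \in F -> t <> 1%g -> X w -> w p -> w t ->
     ~ translate t^-1%g w p) ->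
  fs_mul (fs_star iso) (fs_mul b iso) =
  single (fun w => chi X 1%g w * b 1%g (translate p w)) 1%g.
Proof.
move=> fb hF free; have [cb _] := fb.
apply/funext => r; apply/funext => w; rewrite fs_star_iso.
rewrite fs_mul_singlel; last exact: total_at_C0_U.
rewrite invgK fs_mul_singler // /single.
have [->|r1] := eqVneq r 1%g.
  by rewrite mulg1 mulgV invg1 translate1 mulrCA chi_translate mulrC.
apply/eqP; rewrite !mulf_eq0; apply: contrapT => /negP.
rewrite !negb_or => /and3P[n1 n2 n3].
have [Xw w1] := C0_U_out (@chi_C0_U _ _ _ _) n1.
have [Xpw tw] := C0_U_out (cb _) n2.
have [_ tp] := C0_U_out (@chi_C0_U _ _ _ _) n3.
apply: free tp => //.
- by apply: contrapT => /negP/hF h; rewrite h eqxx in n2.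
- move=> h; move/eqP: r1; apply; apply: (@mulgI _ p); rewrite mulg1.
  by apply: (@mulIg _ p^-1%g); rewrite h mulgV.
- by rewrite translateE mulVg.
Qed.

End Compression.

(** * Representations with dense range *)

Section Representation.
Context {A : cstarType R}.
Variables (i : fsum -> A) (hi : star_rep X i).
Hypothesis idense : closure (i @` finite_sum X) = setT.
Local Notation "x ** y" := (cmul x y) (at level 40, left associativity).
Local Notation e := (i unit1).

Lemma finite_sum_unit : finite_sum X (unit1 : fsum).
Proof. exact/finite_sum_single/chi_C0_U. Qed.

Lemma rep_dense x (d : R) : 0 < d -> exists2 a, finite_sum X a & nrm (x - i a) < d.
Proof.
move=> d0; have : closure (i @` finite_sum X) x by rewrite idense.
by move=> /closure_nrm /(_ _ d0)[_ [a fa <-] ?]; exists a.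
Qed.

Lemma rep_mul a b : finite_sum X a -> finite_sum X b -> i (fs_mul a b) = i a ** i b.
Proof. by move=> fa fb; have [] := hi fa fb. Qed.

Lemma rep_star a : finite_sum X a -> i (fs_star a) = cstar (i a).
Proof. by move=> fa; have [] := hi fa fa. Qed.

Lemma rep_lin k a b : finite_sum X a -> finite_sum X b ->
  i (fs_lin k a b) = k *: i a + i b.
Proof. by move=> fa fb; have [] := hi fa fb. Qed.

(** The identity holds on finite sums and extends by density, multiplication by [e] being
    Lipschitz. *)
Lemma rep_unit : is_unit e.
Proof.
have key (T : A -> A) : (forall x y, nrm (T x - T y) <= nrm e * nrm (x - y)) ->
    (forall a, finite_sum X a -> T (i a) = i a) -> forall x, T x = x.
  move=> lipT Tid x; apply: eq_of_nrm_small => d d0.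
  have e0 := nrm_ge0 e.
  have [|a fa ha] := @rep_dense x (d / (nrm e + 1)).
    by rewrite divr_gt0 // ltr_wpDl.
  apply: le_trans (nrm_sub_trans (i a) _ _) _.
  move: ha; rewrite ltr_pdivlMr ?ltr_wpDl //.
  rewrite (nrmBC (i a) x); have := lipT x (i a); rewrite Tid //.
  have := nrm_ge0 (x - i a); nra.
move=> x; split.
  apply: (key (fun x => e ** x)) => [{}x y|a fa]; first by rewrite -cmulBr nrmM.
  by rewrite -rep_mul ?fs_mul1l //; exact: finite_sum_unit.
apply: (key (fun x => x ** e)) => [{}x y|a fa].
  by rewrite -cmulBl mulrC nrmM.
by rewrite -rep_mul ?fs_mul1r //; exact: finite_sum_unit.
Qed.

Lemma rep_zero : i (fun _ _ => 0) = 0.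
Proof.
have f0 : finite_sum X (fun _ _ => 0 : R[i]).
  apply: finite_sumP => [t|]; last by exists [::].
  by apply/C0_UP; split=> //; exact: continuous_on_cst.
have := rep_lin (-1) f0 f0; rewrite scaleN1r addNr => <-; congr i.
by apply/funext => t; apply/funext => w; rewrite /fs_lin mulr0 addr0.
Qed.

Lemma C0_U1_lin k f g : C0_U X 1%g f -> C0_U X 1%g g ->
  C0_U X 1%g (fun w => k * f w + g w).
Proof.
move=> /C0_UP[f1 f2] /C0_UP[g1 g2]; apply/C0_UP; split=> [|w nw].
  exact: (continuous_onD (continuous_onM (@continuous_on_cst _ _ X k) f1) g1).
by rewrite f2 // g2 // mulr0 addr0.
Qed.

Lemma C0_U1_mul f g : C0_U X 1%g f -> continuous_on X g ->
  C0_U X 1%g (fun w => f w * g w).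
Proof.
move=> /C0_UP[f1 f2] g1; apply/C0_UP; split=> [|w nw]; first exact: continuous_onM.
by rewrite f2 // mul0r.
Qed.

Lemma C0_U1_conj f : C0_U X 1%g f -> C0_U X 1%g (fun w => Num.conj (f w)).
Proof.
move=> /C0_UP[f1 f2]; apply/C0_UP; split=> [|w nw]; first exact: continuous_on_conj.
by rewrite f2 // conjC0.
Qed.

Lemma repC_lin k f g : C0_U X 1%g f -> C0_U X 1%g g ->
  i (single (fun w => k * f w + g w) 1%g) = k *: i (single f 1%g) + i (single g 1%g).
Proof.
move=> cf cg; rewrite -rep_lin; try exact: finite_sum_single.
congr i; apply/funext => s; apply/funext => w; rewrite /fs_lin /single.
by case: eqP; rewrite // mulr0 addr0.
Qed.

Lemma repC_mul f g : C0_U X 1%g f -> C0_U X 1%g g ->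
  i (single (fun w => f w * g w) 1%g) = i (single f 1%g) ** i (single g 1%g).
Proof.
move=> cf cg; rewrite -rep_mul; try exact: finite_sum_single.
congr i; apply/funext => s; apply/funext => w; rewrite fs_mul_singlel //.
by rewrite invg1 mul1g translate1 /single; case: eqP; rewrite // mulr0.
Qed.

Lemma repC_conj f : C0_U X 1%g f ->
  i (single (fun w => Num.conj (f w)) 1%g) = cstar (i (single f 1%g)).
Proof.
move=> cf; rewrite -rep_star; last exact: finite_sum_single.
rewrite fs_star_single // invg1; congr (i (single _ _)); apply/funext => w.
by rewrite translate1.
Qed.

(* A real function [f] with [|f| <= 1] is the real part of the unitary
   [f + i (1 - f^2)^(1/2)]. *)
Lemma repC_real_le1 f : C0_U X 1%g f -> (forall w, Num.conj (f w) = f w) ->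
  (forall w, `|f w| <= 1) -> nrm (i (single f 1%g)) <= 1.
Proof.
move=> cf fR f1; have [cfc _] := iffLR (C0_UP _ _ _) cf.
pose g w : R[i] := chi X 1%g w * cos_to_sin (f w).
have cg : C0_U X 1%g g.
  by apply: C0_U1_mul; [exact: chi_C0_U|exact: continuous_on_cos_to_sin].
pose u w := 'i * g w + f w.
have cu : C0_U X 1%g u by exact: C0_U1_lin.
have uu w : Num.conj (u w) * u w = chi X 1%g w.
  have fE : f w = (complex.Re (f w))%:C.
    by rewrite RRe_real //; apply/CrealP.
  have [chi0|/(C0_U_out (@chi_C0_U _ _ _ _))[Xw w1]] := eqVneq (chi X 1%g w) (0 : R[i]).
    by rewrite /u /g (C0_U1_out w cf) chi0 !mul0r mulr0 addr0 mulr0.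
  rewrite /u /g chi_in // !mul1r /cos_to_sin.
  set c := Num.sqrt _; have cc : c ^+ 2 = 1 - complex.Re (f w) ^+ 2.
    rewrite sqr_sqrtr // subr_ge0 -[X in _ <= X](expr1n _ 2).
    have := f1 w; rewrite {1}fE normc_def /= expr0n addr0 sqrtr_sqr.
    rewrite -(rmorph1 (real_complex R)) lecR => h.
    by rewrite -ler_sqrt ?expr1n // sqrtr_sqr sqrtr1.
  rewrite rmorphD rmorphM /= conjCi fR conj_realC {1 2}fE.
  have -> : (- 'i * c%:C + (complex.Re (f w))%:C) * ('i * c%:C + (complex.Re (f w))%:C) =
     (c ^+ 2 + complex.Re (f w) ^+ 2)%:C :> R[i].
    rewrite rmorphD !rmorphXn /=.
    transitivity (- 'i ^+ 2 * c%:C ^+ 2 + (complex.Re (f w))%:C ^+ 2 : R[i]); first ring.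
    by rewrite sqrCi opprK mul1r.
  by rewrite cc subrK.
have U1 : nrm (i (single u 1%g)) <= 1.
  have := nrm_cstarM (i (single u 1%g)).
  rewrite -repC_conj // -repC_mul //; last exact: C0_U1_conj.
  rewrite (_ : (fun w => _ * u w) = chi X 1%g); last by apply/funext => w; exact: uu.
  have := nrm_projection_le1 (is_unit_projection rep_unit).
  have := nrm_ge0 (i (single u 1%g)); nra.
have -> : i (single f 1%g) =
    (2^-1 : R)%:C *: (i (single u 1%g) + cstar (i (single u 1%g))).
  rewrite /u repC_lin // cstarD cstarZ conjCi -!repC_conj //.
  rewrite (_ : (fun w => Num.conj (f w)) = f); last by apply/funext.
  rewrite (_ : (fun w => Num.conj (g w)) = g); last first.
    apply/funext => w; rewrite /g rmorphM /= conj_realC /chi.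
    by case: ifP; rewrite ?conjC1 ?conjC0.
  by rewrite scaleNr addrACA subrr add0r half_add // half2.
rewrite nrm_half; have := nrmD (i (single u 1%g)) (cstar (i (single u 1%g))).
by rewrite nrm_cstar; lra.
Qed.

(** By the C*-identity it suffices to bound the image of the real function |f|^2 / d^2, which is at
    most 1. *)
Lemma repC_contractive f (d : R) : 0 < d -> C0_U X 1%g f ->
  (forall w, `|f w| <= d%:C) -> nrm (i (single f 1%g)) <= d.
Proof.
move=> d0 cf fd; have d0' : d != 0 by rewrite gt_eqF.
pose g w := Num.conj (f w) * f w.
have cg : C0_U X 1%g g.
  by apply: C0_U1_mul; [exact: C0_U1_conj|have /C0_UP[] := cf].
pose k : R[i] := (d ^- 2)%:C.
(* The zero summand turns [repC_lin] into a rule for scalar multiples. *)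
pose z (_ : subsets G) : R[i] := 0.
have cz : C0_U X 1%g z by apply/C0_UP; split=> //; exact: continuous_on_cst.
have iz : i (single z 1%g) = 0.
  rewrite -rep_zero; congr i; apply/funext => s; apply/funext => w.
  by rewrite /single /z if_same.
have h : nrm (i (single (fun w => k * g w + z w) 1%g)) <= 1.
  apply: repC_real_le1; first exact: C0_U1_lin.
    move=> w; rewrite /z addr0 rmorphM /= conj_realC.
    by rewrite /g rmorphM /= conjCK [f w * _]mulrC.
  move=> w; rewrite /z addr0 /k /g -normCKC normrM normrX normr_id.
  rewrite normc_def /= expr0n addr0 sqrtr_sqr ger0_norm; last first.
    by rewrite invr_ge0 exprn_ge0 // ltW.
  have := fd w; rewrite normc_def -rmorphXn -rmorphM /=.
  rewrite -(rmorph1 (real_complex R)) !lecR => h.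
  rewrite ler_pdivrMl ?exprn_gt0 // mulr1 ler_pXn2r ?nnegrE ?sqrtr_ge0 ?(ltW d0) //.
move: h; rewrite (repC_lin k cg cz) iz addr0 nrmZr /g repC_mul //; last exact: C0_U1_conj.
rewrite repC_conj // nrm_cstarM ger0_norm; last by rewrite invr_ge0 exprn_ge0 // ltW.
rewrite ler_pdivrMl ?exprn_gt0 // mulr1 ler_pXn2r ?nnegrE ?nrm_ge0 ?(ltW d0) //.
Qed.

End Representation.
End FiniteSums.

(** * The boundary quotient *)

Section BoundaryQuotient.
Context {R : realType} {G : groupType}.
Variables (P : set G) (hP : quasi_lattice_ordered P).
Local Notation X := (boundary_spectrum P).
Local Notation fsum := (G -> subsets G -> R[i]).
Local Notation unit1 := (single (chi X 1%g) 1%g).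

Let X1 : forall w, X w -> w 1%g := @boundary1 G P.
Let XV : forall t w, X w -> w t -> X (translate t^-1%g w) :=
  @boundary_translateV G P.

Lemma boundary_total p : P p -> total_at X p.
Proof.
move=> Pp w Xw; split; first exact: boundary_translate.
by have [[w1 hw _] _] := Xw; have := hw _ _ w1 Pp; rewrite mul1g.
Qed.

(** The unit is itself a test vector of l2-norm 1, as [X] is nonempty. This shows later that the
    crossed product is nonzero. *)
Lemma reduced_norm_unit : 1 <= reduced_norm X (unit1 : fsum).
Proof.
have [m /(maximal_directed_boundary hP) Xm] := maximal_directed_exists hP.
have f1 : finite_sum X (unit1 : fsum) by exact: finite_sum_unit.
have t1 : total_at X 1%g.
  by move=> w Xw; rewrite translate1 invg1; split=> //; exact: X1.
have l1 : l2_norm X (unit1 : fsum) = 1.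
  rewrite /l2_norm (iso_isometry X1 XV t1) /single eqxx /sup_norm.
  rewrite (_ : [set _ | _ in _] = [set 1]) ?sup1 ?sqrtr1 //.
  apply/seteqP; split=> [_ [w Xw <-]|_ ->].
    by rewrite chi_in ?normr1 //; apply: X1.
  by exists m => //; rewrite chi_in ?normr1 //; apply: X1.
apply: ub_le_sup.
  by exists 1 => _ [x [fx x1] <-]; rewrite (fs_mul1l X1).
by exists unit1; [split=> //; rewrite l1|rewrite (fs_mul1l X1)].
Qed.

Hypothesis hfree : topologically_free X.

(** * Compressions in a representation over the boundary *)

Section Representation.
Context {A : cstarType R}.
Variables (i : fsum -> A) (hi : star_rep X i).
Hypothesis idense : closure (i @` finite_sum X) = setT.
Local Notation "x ** y" := (cmul x y) (at level 40, left associativity).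
Local Notation e := (i unit1).
Hypothesis e0 : e <> 0.

Let he : is_unit e := rep_unit X1 XV hi idense.

Lemma boundary_isometry p : P p ->
  cstar (i (single (chi X p) p)) ** i (single (chi X p) p) = e.
Proof.
move=> /boundary_total tp; have f : finite_sum X (single (chi X p) p : fsum).
  exact/finite_sum_single/chi_C0_U.
rewrite -(rep_star hi) // -(rep_mul hi) //; last exact: finite_sum_star.
by rewrite (iso_isometry X1 XV tp).
Qed.

Lemma isometry_nrm v : cstar v ** v = e -> nrm v = 1.
Proof.
move=> vv; have := nrm_cstarM v; rewrite vv nrm_projection //.
  by have := nrm_ge0 v; nra.
exact: is_unit_projection.
Qed.

Lemma near_C0_U t (f : subsets G -> R[i]) w (d : R) : C0_U X t f -> X w -> 0 < d ->
  nbhs w [set v | X v -> complex.Re `|f v - f w| < d].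
Proof.
move=> /C0_UP[cf _] Xw d0; have d0C : 0 < (d%:C : R[i]) by rewrite ltcR.
have /cvgrPdist_lt/(_ _ d0C) := cf _ Xw; rewrite near_withinE.
by apply: filterS => v h Xv; have := h Xv; rewrite distrC -ltcR RRe_real.
Qed.

(* Near [w], compressing by the isometry of a small enough cylinder kills the
   coefficients off the unit and turns the one at the unit into a scalar. *)
Lemma compression (b1 b2 : fsum) w (d : R) : finite_sum X b1 -> finite_sum X b2 ->
  X w -> 0 < d ->
  exists v, [/\ cstar v ** v = e,
    nrm (cstar v ** (i b1 ** v) - b1 1%g w *: e) <= d &
    nrm (cstar v ** (i b2 ** v) - b2 1%g w *: e) <= d].
Proof.
move=> f1 f2 Xw d0; have [F1 _ hF1] := finite_sum_supp f1.
have [F2 _ hF2] := finite_sum_supp f2.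
have := @filterI _ (nbhs w) (nbhs_filter w) _ _
  (near_C0_U (f1.1 1%g) Xw d0) (near_C0_U (f2.1 1%g) Xw d0).
rewrite nbhsE => -[U [oU Uw] hU].
(* Inverses are listed because [compressionE] translates by [t^-1] where [boundary_free_base]
   translates by [t]. Both supports are treated at once, so that one isometry serves [b1] and
   [b2]. *)
have [|p [Pp _ pU pfree]] :=
  @boundary_free_base _ _ hP hfree [seq s^-1%g | s <- F1 ++ F2] U oU.
  by exists w.
have tp := boundary_total Pp.
set v0 : fsum := single (chi X p) p.
have fv : finite_sum X v0 by exact/finite_sum_single/chi_C0_U.
exists (i v0); have key (b : fsum) F : finite_sum X b -> supp_in F b ->
    {subset F <= F1 ++ F2} ->
    (forall v, U v -> X v -> complex.Re `|b 1%g v - b 1%g w| < d) ->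
    nrm (cstar (i v0) ** (i b ** i v0) - b 1%g w *: e) <= d.
  move=> fb hF sF bU; pose g v := chi X 1%g v * b 1%g (translate p v).
  have E : fs_mul (fs_star v0) (fs_mul b v0) = single g 1%g.
    apply: (compressionE X1 XV tp fb hF) => t v tF t1 Xv vp vt.
    apply: pfree => //; last by rewrite invgK.
      by rewrite map_f // sF.
    by move=> tV; apply: t1; rewrite -[t]invgK tV invg1.
  have fbv := finite_sum_mul X1 XV fb fv.
  have fs := finite_sum_star X1 XV fv.
  have cg : C0_U X 1%g g.
    have := (finite_sum_mul X1 XV fs fbv).1 1%g; rewrite E.
    by rewrite (_ : single g 1%g 1%g = g) // /single eqxx.
  rewrite -(rep_star hi) // -!(rep_mul hi) // E addrC -scaleNr.
  rewrite -(repC_lin hi) //; last exact: chi_C0_U.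
  apply: (repC_contractive X1 XV hi idense d0).
    by apply: C0_U1_lin => //; exact: chi_C0_U.
  move=> u; have [c0|/(C0_U_out (@chi_C0_U _ _ _ _))[Xu u1]] := eqVneq (chi X 1%g u) (0 : R[i]).
    by rewrite /g c0 mulr0 mul0r addr0 normr0 lecR ltW.
  have [Xpu _] := tp _ Xu.
  have pup : translate p u p by rewrite translateE mulVg.
  have := bU _ (pU _ Xpu pup) Xpu.
  rewrite /g chi_in // mulr1 mul1r addrC -ltcR RRe_real ?ger0_real //.
  exact: ltW.
split; first exact: boundary_isometry.
  apply: (key _ F1) => // [s sF|v Uv Xv]; first by rewrite mem_cat sF.
  by have [h _] := hU _ Uv; apply: h.
apply: (key _ F2) => // [s sF|v Uv Xv]; first by rewrite mem_cat sF orbT.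
by have [_ h] := hU _ Uv; apply: h.
Qed.

(** Compressing by an isometry does not increase the norm and brings [b] within [d] of the scalar
    [b 1 w]. This plays the role of a contractive conditional expectation. *)
Lemma expectation_le (b : fsum) w : finite_sum X b -> X w ->
  complex.Re `|b 1%g w| <= nrm (i b).
Proof.
move=> fb Xw; apply/ler_addgt0Pr => d d0.
have [v [vv hv _]] := compression fb fb Xw d0.
have v1 := isometry_nrm vv.
have e1 : nrm e = 1 by apply: nrm_projection => //; exact: is_unit_projection.
rewrite -[complex.Re _]mulr1 -e1 -nrmZ.
have := nrmBC (b 1%g w *: e) (cstar v ** (i b ** v)).
have := nrmD (b 1%g w *: e - cstar v ** (i b ** v)) (cstar v ** (i b ** v)).
rewrite subrK; have := nrmM (cstar v) (i b ** v); have := nrmM (i b) v.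
rewrite nrm_cstar v1; lra.
Qed.

(** For S = chi_t delta_t, the coefficient of S S^* at 1 vanishes at a point [w] not containing [t],
    while that of the unit is 1 there. *)
Lemma boundary_proper_isometry : P <> [set 1%g] ->
  exists2 S, cstar S ** S = e & S ** cstar S <> e.
Proof.
move=> /(boundary_proper hP hfree)[t [w [Pt Xw wt]]].
exists (i (single (chi X t) t)); first exact: boundary_isometry.
have f : finite_sum X (single (chi X t) t : fsum).
  exact/finite_sum_single/chi_C0_U.
have fs := finite_sum_star X1 XV f; have tt := boundary_total Pt.
have f1 : finite_sum X (unit1 : fsum) by exact: finite_sum_unit.
have fm := finite_sum_mul X1 XV f fs.
rewrite -(rep_star hi) // -(rep_mul hi) // => h.
have := expectation_le (finite_sum_lin (-1) fm f1) Xw.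
rewrite (rep_lin hi) // h scaleN1r addNr nrm0 /fs_lin.
rewrite (fs_mul_singlel X1); last exact: chi_C0_U.
rewrite [chi X t w](_ : _ = 0); last by rewrite /chi (negbTE (introN idP wt)) andbF.
rewrite mul0r mulr0 add0r /single eqxx chi_in //; last exact: X1.
by rewrite normr1 /= ler10.
Qed.

Lemma l2_norm_le1 (z : fsum) w : finite_sum X z -> l2_norm X z <= 1 -> X w ->
  complex.Re `|fs_mul (fs_star z) z 1%g w| <= 1.
Proof.
move=> fz z1 Xw; have fzz := finite_sum_mul X1 XV (finite_sum_star X1 XV fz) fz.
apply: (@le_trans _ _ (sup_norm X (fs_mul (fs_star z) z 1%g))).
  apply: ub_le_sup; last by exists w.
  (* This upper bound makes [sup_norm] a genuine supremum. *)
  exists (nrm (i (fs_mul (fs_star z) z))) => _ [v Xv <-]; exact: expectation_le.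
move: z1; rewrite /l2_norm -{1}(sqrtr1 R) leNgt => h; rewrite leNgt; apply: contra h => h.
by rewrite ltr_sqrt // (lt_trans ltr01).
Qed.

(** A set that is empty or unbounded above has [sup] equal to 0 by convention; positivity of [c]
    rules this out. *)
Lemma sup_gt (S : set R) (c : R) : 0 < c -> c < sup S -> exists2 x, S x & c < x.
Proof.
move=> c0 cS; have hs : has_sup S.
  by apply: contrapT => /sup_out S0; move: cS; rewrite S0; lra.
have [x Sx h] := sup_adherent (ltac:(by rewrite subr_gt0) : 0 < sup S - c) hs.
by exists x => //; move: h; rewrite subKr.
Qed.

Lemma l2_norm_gt (a : fsum) (c : R) : 0 < c -> c < l2_norm X a ->
  exists2 w, X w & c ^+ 2 < complex.Re `|fs_mul (fs_star a) a 1%g w|.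
Proof.
move=> c0 ca; have h : c ^+ 2 < sup_norm X (fs_mul (fs_star a) a 1%g).
  rewrite ltNge; apply/negP => h; move: ca; rewrite /l2_norm ltNge => /negP; apply.
  rewrite -(ger0_norm (ltW c0)) -sqrtr_sqr; exact: ler_wsqrtr.
by have [_ [w Xw <-] ?] := sup_gt (exprn_gt0 2 c0) h; exists w.
Qed.

(** The form in which amenability enters this section; the factor 2 is that of
    [star_hom_bounded]. *)
Hypothesis hbound : forall a, finite_sum X a -> nrm (i a) <= 2 * reduced_norm X a.

(* The vector [z] nearly realizing the reduced norm of [b ~ x] is compressed
   together with [b z], so that [y0 = i z ** v] stays bounded and
   [cstar (x ** y0) ** (x ** y0)] is nearly a scalar. *)
Lemma compress_to_unit x : x <> 0 ->
  exists y, nrm (cstar (x ** y) ** (x ** y) - e) <= 1 / 2.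
Proof.
move=> x0; have N0 := nrm_gt0 x0; set N := nrm x in N0.
(* The image of [b] has norm at least 999/1000 of [N], so its reduced norm is at least 999/2000 of
   [N], above 2/5. *)
have [b fb xb] := rep_dense idense x (ltac:(lra) : 0 < N / 1000).
have rb : N * (2 / 5) < reduced_norm X b.
  have := hbound fb; have := nrmD (x - i b) (i b); rewrite subrK -/N; lra.
have [_ [z [fz z1] <-] bz] := sup_gt (ltac:(lra) : 0 < N * (2 / 5)) rb.
have fa := finite_sum_mul X1 XV fb fz.
have [w Xw hw] := l2_norm_gt (ltac:(lra) : 0 < N * (2 / 5)) bz.
have fsa := finite_sum_star X1 XV fa; have fc := finite_sum_mul X1 XV fsa fa.
have fsz := finite_sum_star X1 XV fz; have fzz := finite_sum_mul X1 XV fsz fz.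
have zw := l2_norm_le1 fz z1 Xw.
set a := fs_mul b z in fa hw fsa fc.
pose l := complex.Re `|fs_mul (fs_star a) a 1%g w|.
have lE : fs_mul (fs_star a) a 1%g w = l%:C.
  by rewrite RRe_real ?ger0_real // ger0_norm // (fs_star_mul1 X1 XV).
(* The bound 1 on [d] gives [nrm y ^+ 2 <= 2]. The bound N^2 / 100 keeps the total error below l /
   2, where l exceeds 4/25 of N^2. *)
pose d := Num.min 1 (N ^+ 2 / 100).
have d0 : 0 < d by rewrite lt_min ltr01 divr_gt0 // exprn_gt0.
have d1 : d <= 1 by rewrite ge_min lexx.
have d2 : d <= N ^+ 2 / 100 by rewrite ge_min lexx orbT.
have [v [vv hv hz]] := compression fc fzz Xw d0.
pose y := i z ** v.
have e1 : nrm e = 1 by apply: nrm_projection => //; exact: is_unit_projection.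
have y2 : nrm y ^+ 2 <= 2.
  rewrite -nrm_cstarM cstarM -!cmulA (cmulA (cstar (i z))) -(rep_star hi) //.
  rewrite -(rep_mul hi) //; set T := cstar v ** _.
  have := nrmD (T - fs_mul (fs_star z) z 1%g w *: e) (fs_mul (fs_star z) z 1%g w *: e).
  by rewrite subrK nrmZ e1; lra.
have by' : cstar (i b ** y) ** (i b ** y) = cstar v ** (i (fs_mul (fs_star a) a) ** v).
  by rewrite (rep_mul hi) // (rep_star hi) // (rep_mul hi) // /y !cstarM !cmulA.
rewrite lE -by' in hv.
pose p := x ** y; pose q := i b ** y.
have pq : nrm (p - q) <= N / 1000 * nrm y.
  rewrite -cmulBl; have := nrmM (x - i b) y; have := nrm_ge0 y; nra.
have pn : nrm p <= N * nrm y by exact: nrmM.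
have qn : nrm q <= 2 * N * nrm y.
  have := nrmD (q - p) p; rewrite subrK (nrmBC q); have := nrm_ge0 y; nra.
have pp : nrm (cstar p ** p - l%:C *: e) <= l / 2.
  have -> : cstar p ** p - l%:C *: e =
      cstar p ** (p - q) + cstar (p - q) ** q + (cstar q ** q - l%:C *: e).
    by rewrite cmulBr cstarB cmulBl !addrA !subrK.
  have := nrmD (cstar p ** (p - q) + cstar (p - q) ** q) (cstar q ** q - l%:C *: e).
  have := nrmD (cstar p ** (p - q)) (cstar (p - q) ** q).
  have := nrmM (cstar p) (p - q); have := nrmM (cstar (p - q)) q.
  rewrite !nrm_cstar; rewrite -/l in hw; rewrite -/q in hv.
  have y0 := nrm_ge0 y; have pq0 := nrm_ge0 (p - q).
  have h1 : nrm p * nrm (p - q) <= N ^+ 2 / 1000 * nrm y ^+ 2.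
    by have := nrm_ge0 p; nra.
  have h2 : nrm (p - q) * nrm q <= N ^+ 2 / 500 * nrm y ^+ 2.
    by have := nrm_ge0 q; nra.
  have h3 : N ^+ 2 * nrm y ^+ 2 <= N ^+ 2 * 2 by rewrite ler_wpM2l ?exprn_ge0 ?(ltW N0).
  rewrite exprMn in hw; lra.
have l0 : 0 < l by apply: lt_trans hw; rewrite exprn_gt0 //; lra.
(* Dividing [y] by the square root of [l] moves the scalar to 1 and the error to at most 1/2. *)
pose s := Num.sqrt l; have ss : s ^+ 2 = l by rewrite sqr_sqrtr // ltW.
exists ((s^-1)%:C *: y); rewrite cmulZr -/p cstarZr cmulZl cmulZr scalerA.
have -> : (s^-1)%:C * (s^-1)%:C = (l^-1)%:C :> R[i].
  by rewrite -rmorphM -invfM -expr2 ss.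
have -> : (l^-1)%:C *: (cstar p ** p) - e = (l^-1)%:C *: (cstar p ** p - l%:C *: e).
  rewrite scalerBr scalerA -rmorphM mulVf ?gt_eqF // rmorph1 scale1r //.
by rewrite nrmZr gtr0_norm ?invr_gt0 // ler_pdivrMl // mulrC -mulrA mul1r mulrC; lra.
Qed.

End Representation.
End BoundaryQuotient.

(** * Passage between full and reduced crossed products, and conclusion *)

Lemma bijective_star_hom_inv (R : realType) (A B : cstarType R) (f : A -> B) :
  star_hom f -> bijective f ->
  exists g, [/\ star_hom g, cancel f g & cancel g f].
Proof.
move=> [lin hM hs] [g fK gK]; exists g; split=> //; split.
- by move=> k x y; apply: (can_inj fK); rewrite lin !gK.
- by move=> x y; apply: (can_inj fK); rewrite hM !gK.
- by move=> x; apply: (can_inj fK); rewrite hs !gK.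
Qed.

Lemma star_hom_comp (R : realType) (A B C : cstarType R) (f : A -> B) (g : B -> C) :
  star_hom f -> star_hom g -> star_hom (g \o f).
Proof.
move=> [fl fM fs] [gl gM gs]; split=> [k x y|x y|x] /=.
- by rewrite fl gl.
- by rewrite fM gM.
- by rewrite fs gs.
Qed.

Lemma star_hom0 (R : realType) (A B : cstarType R) (f : A -> B) : star_hom f -> f 0 = 0.
Proof. by move=> hf; rewrite -(scale0r (0 : A)) star_homZ // scale0r. Qed.

(* The case P = {1} has to be excluded: the boundary spectrum is then the point
   {1}, the partial action is trivially amenable and topologically free, and
   the crossed product is the field of complex numbers, which is simple but not
   purely infinite. *)
Theorem theorem5p1 (R : realType) (G : groupType) (P : set G)
    (hG : countable [set: G])
    (hP : quasi_lattice_ordered P)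
    (hP1 : P <> [set 1%g])
    (hamenable : amenable R (boundary_spectrum P))
    (hfree : topologically_free (boundary_spectrum P))
    (A : cstarType R) (i : (G -> subsets G -> R[i]) -> A)
    (hA : full_crossed_product (boundary_spectrum P) i) :
  purely_infinite A /\ cstar_simple A.
Proof.
have [hi idense univ] := hA.
have [A' [Ar [i' [j [f [[hi' _ univ'] [hj jdense jn] hf fij fbij]]]]]] := hamenable.
have [g [hg fK gK]] := bijective_star_hom_inv hf fbij.
have [h hh hi'i] := univ' _ _ hi.
set X := boundary_spectrum P in hi idense univ hi' univ' hj jdense jn fij h hh hi'i *.
have X1 : forall w, X w -> w 1%g by exact: boundary1.
have XV : forall t w, X w -> w t -> X (translate t^-1%g w).
  exact: boundary_translateV.
pose u : G -> subsets G -> R[i] := single (chi X 1%g) 1%g.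
have fu : finite_sum X u by exact: finite_sum_unit.
(* Universality maps [A] to [A'] and then to [Ar], where the image of [u] has norm at least 1. *)
have e0 : i u <> 0.
  move=> iu0; have [k hk ik] := univ _ _ hi'.
  have ju0 : j u = 0 by rewrite -fij // -ik // iu0 star_hom0 // star_hom0.
  have := @reduced_norm_unit R G P hP; rewrite -lecR -jn // ju0 normr0.
  by rewrite lecR ler10.
(* Universality of [A'] and the inverse of [f] factor [i] through [j], whose norm is the reduced
   norm. *)
have hbound a : finite_sum X a -> nrm (i a) <= 2 * reduced_norm X a.
  move=> fa; have -> : i a = h (g (j a)) by rewrite -fij // fK hi'i.
  have := star_hom_bounded (star_hom_comp hg hh) (rep_unit X1 XV hj jdense) (j a).
  by rewrite /= {2}/nrm jn.
apply: (@purely_infinite_simple _ _ (i u)) => //.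
- exact: (rep_unit X1 XV hi idense).
- exact: (compress_to_unit hP hfree hi idense e0 hbound).
- exact: (boundary_proper_isometry hP hfree hi idense e0 hP1).
Qed.
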